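(* Let $p$ be an odd prime and let $m,\ell$ be positive integers such that $\ell\mid m$, $m_\ell=\frac m\ell$ is even and $m>6\ell$. If $\frac12m_\ell$ is odd (resp. even), then the Artin–Schreier curve $$C_{\gamma_1,\gamma_2,\beta}:\quad y^p-y=\gamma_1x^{p^{3\ell}+1}+\gamma_2x^{p^\ell+1}+\beta x$$ over $\mathbb{F}_{p^m}$ is maximal (resp. minimal) for some $\gamma_1,\gamma_2\in\mathbb{F}_{p^m}^*$ and $\beta\in\mathbb{F}_{p^m}$.
   Context: $C_{\gamma_1,\gamma_2,\beta}$ denotes the smooth projective model of the affine curve (with one point at infinity). A curve $C$ of genus $g$ over $\mathbb{F}_{p^m}$ is maximal (resp. minimal) if $\#C(\mathbb{F}_{p^m})=p^m+1+2g\,p^{m/2}$ (resp. $p^m+1-2g\,p^{m/2}$), i.e. it attains the upper (resp. lower) Hasse–Weil bound. *)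

(* Defs.v *)
From HB Require Import structures.
From mathcomp Require Import all_boot all_order all_algebra all_field.
From mathcomp Require Import boolp classical_sets functions cardinality.

Set Implicit Arguments.
Unset Strict Implicit.
Unset Printing Implicit Defensive.

Import GRing.Theory Num.Theory.
Local Open Scope ring_scope.

(* Smooth projective curves over a finite field K are represented by their
   function field L, given as a finite extension phi of K(x).  The smooth
   projective model X is the normalization of P^1 in L: with O0 and O1 the
   integral closures of K[x] and K[1/x] in L, it is glued from Spec O0 and
   Spec O1 along the open subset x != 0 of Spec O0, whose ring is O0[1/x].
   (K is perfect, so normal curves are smooth.) *)
Section SmoothProjectiveModel.

Variables (K : finFieldType) (L : comNzRingType).
Variable phi : {rmorphism {fraction {poly K}} -> L}.

Definition constK (c : K) : L := phi (tofrac c%:P).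
Definition xcoord : L := phi (tofrac 'X).
Definition xinv : L := phi (tofrac 'X)^-1.

(* integralOver takes a ring map {poly K} -> L; here it is 'X |-> t. *)
Definition integral_closure (t : L) : set L :=
  [set z | integralOver (fun q : {poly K} => (map_poly constK q).[t]) z].

Definition O0 : set L := integral_closure xcoord.
Definition O1 : set L := integral_closure xinv.
Definition O01 : set L := [set z | exists n : nat, O0 (xcoord ^+ n * z)].

(* A K-rational point of Spec A is a maximal ideal M of A with A / M = K, that
   is, an ideal M such that A is the direct sum of K and M. *)
Definition rational_point (A M : set L) : Prop :=
  [/\ (M `<=` A)%classic,
      M 0,
      forall a b, M a -> M b -> M (a + b),
      forall a b, A a -> M b -> M (a * b)
    & forall a, A a -> exists! c : K, M (a - constK c)].

(* X(K): the rational points of Spec O0, and those of Spec O1 outside the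
   overlap, i.e. with 1/x = 0. *)
Definition rational_points : set (set L + set L) :=
  [set P | match P with
           | inl M => rational_point O0 M
           | inr M => rational_point O1 M /\ M xinv
           end].

Definition num_points (N : nat) : Prop := (rational_points #= `I_N)%card.

Definition quotient_dim (V W : set L) (g : nat) : Prop :=
  exists b : 'I_g -> L, (forall i, V (b i)) /\
    forall z, V z -> exists! c : {ffun 'I_g -> K},
      W (z - \sum_i constK (c i) * b i).

(* The genus is dim_K H^1(X, O_X), and H^1(X, O_X) = O01 / (O0 + O1) is the
   Cech cohomology of the above affine cover. *)
Definition genus (g : nat) : Prop :=
  quotient_dim O01 [set z | exists u v, [/\ O0 u, O1 v & z = u + v]] g.

Definition maximal : Prop := exists N g : nat,
  [/\ num_points N, genus g
    & N%:R = #|K|%:R + 1 + 2 * g%:R * sqrtC #|K|%:R :> algC].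

Definition minimal : Prop := exists N g : nat,
  [/\ num_points N, genus g
    & N%:R = #|K|%:R + 1 - 2 * g%:R * sqrtC #|K|%:R :> algC].

End SmoothProjectiveModel.

Section ArtinSchreier.

Variables (K : finFieldType) (p : nat) (f : {poly K}).

Definition AS_poly : {poly {fraction {poly K}}} := 'X^p - 'X - (tofrac f)%:P.

(* {poly %/ h} is the quotient by mk_monic h, which is h only when h is monic
   and nonconstant. *)
Lemma mk_monic_AS_poly : (1 < p)%N -> mk_monic AS_poly = AS_poly.
Proof.
move=> p_gt1; rewrite /mk_monic /AS_poly -addrA.
have szlow : (size (- 'X - (tofrac f)%:P)%R <
    size ('X^p : {poly {fraction {poly K}}})%R)%N.
  rewrite size_polyXn ltnS -opprD size_polyN.
  by rewrite size_XaddC.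
by rewrite size_polyDl // monicE lead_coefDl // lead_coefXn eqxx size_polyXn
  ltnS (ltnW p_gt1).
Qed.

(* The function field K(x)[y] / (y^p - y - f(x)); it is a field as soon as the
   equation is irreducible over K(x). *)
Definition AS_field : comNzRingType := {poly %/ AS_poly}.

Definition AS_embed : {rmorphism {fraction {poly K}} -> AS_field} :=
  qpolyC AS_poly.

End ArtinSchreier.

(* Main.v *)
From HB Require Import structures.
Require Import Defs.
From mathcomp Require Import all_boot all_order all_algebra all_field.
From mathcomp Require Import fingroup cyclic.
From mathcomp Require Import zify ring lra.
Import Order.TTheory GRing.Theory Num.Theory.
Set Implicit Arguments.
Unset Strict Implicit.
Unset Printing Implicit Defensive.
Local Open Scope ring_scope.

(** Write Q = p^l and q = #|K| = Q^(2n), so that n = (m / l) / 2 is at least 4.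
For g = (g1, g2) let h_g(x) = g1 x^(Q^3+1) + g2 x^(Q+1), and let
S(g) = \sum_x psi(h_g x) for a nontrivial additive character psi of K that is
invariant under Frobenius.  The witness is a curve with b = 0.

_The sums._  Since h_g(c x) = c^(Q+1) h_g(x) for c in F_(Q^2), the map
Tr_(K / F_Q) o h_g is a Hermitian form in n variables over F_(Q^2).  Its radical
is the zero set of an additive polynomial of degree at most Q^6, hence has
Q^(2d) elements with d <= 3 when g is nonzero, and S(g) = (-Q)^(n+d)
([hsum_value]): the absolute value comes from S(g)^2 = q Q^(2d), the sign from
S(g) = 1 mod Q+1.  By orthogonality of characters the affine curve
y^p - y = h_g(x) has q + (p-1) S(g) points over K ([curve_count]).  As the genus
is (p-1) Q^3 / 2, one of the two Hasse-Weil bounds is attained exactly when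
d = 3, and the sign (-1)^(n+3) says which one.

_Existence of g with d = 3 and g1, g2 nonzero_ ([exists_hsum]).  Put
T(g) = S(g) / (-Q)^n = (-Q)^d and P(T) = (T-1)(T+Q)(T-Q^2), which vanishes for
d = 0, 1, 2 and is negative for d = 3.  The first three power moments of S over
all g count solutions of a pair of equations in one, two and three unknowns, so
they determine \sum_g P(T(g)); the third one rests on the fact that a common
zero of X^(Q+1) + Y^(Q+1) + Z^(Q+1) and X^(Q^3+1) + Y^(Q^3+1) + Z^(Q^3+1) is
proportional to a point over F_(Q^2) ([hermitian_point]).  If d = 3 occurred
only on the line g2 = 0, the second moment of S along that line would bound the
number of such g by (q-1) / Q^3, which is incompatible with the value of
\sum_g P(T(g)) as soon as n >= 4 ([moment_contradiction]).  And g1 = 0 forces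
d <= 2, because the additive polynomial then has degree at most Q^4.

_The curve._  Let L = K(x)[y] / (y^p - y - f) with d = deg f prime to p.  The
substitution y -> y + 1 makes the leading coefficient of an integral element
integral ([int_lead]), so the integral closure of K[x] is K[x, y] ([O0P]).  At
infinity x and y have poles of order p and d.  As the numbers p a + d i are
distinct for i < p, an element x^-n \sum_i P_i y^i should be regular there
exactly when p deg P_i + d i <= p n for every nonzero P_i.  Sufficiency is a
direct check ([rep_O1]); for necessity ([O1_regular]) the y^0-coefficient of the
p-th power is x^(-pn) \sum_i P_i^p f^i, where nothing cancels, so that an excess
would grow without bound under iterated p-th powers.  With both rings explicit,
the rational points are the affine solutions and one point at infinity
([num_points_AS]), and the monomials x^-j y^i with j > 0 and p j < d i form a
basis of H^1 ([genus_AS]); there are (p-1)(d-1)/2 of them ([card_gaps]). *)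

(** * Roots in a finite field *)

Section RootCounts.
Variable K : finFieldType.

Lemma card_roots (P : {poly K}) : P != 0 -> (#|[set x | root P x]| < size P)%N.
Proof.
move=> P0; rewrite cardE; apply: max_poly_roots => //; last exact: enum_uniq.
by apply/allP => x; rewrite mem_enum inE.
Qed.

Lemma exists_prim_root : exists g : K, (#|K|.-1).-primitive_root g.
Proof.
pose rs := [seq x <- enum K | x != 0].
have szrs : size rs = #|K|.-1.
  rewrite size_filter -(cardC1 (0 : K)) cardE size_filter -enumT.
  by apply: eq_count => x; rewrite !inE.
have q1 : (0 < #|K|.-1)%N by have := finNzRing_gt1 K; case: #|K| => [|[]].
have/hasP[g _ gP] : has (#|K|.-1).-primitive_root rs; last by exists g.
apply: has_prim_root => //; last by rewrite szrs.
  apply/allP => x; rewrite mem_filter => /andP[x0 _]; apply/unity_rootP.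
  by apply: (mulfI x0); rewrite mulr1 -exprS prednK ?expf_card // ltnW ?finNzRing_gt1.
by rewrite filter_uniq // enum_uniq.
Qed.

Lemma expf_card1 (x : K) : x != 0 -> x ^+ #|K|.-1 = 1.
Proof.
move=> x0; apply: (mulfI x0).
by rewrite mulr1 -exprS prednK ?expf_card // ltnW ?finNzRing_gt1.
Qed.

Lemma card_unity d : (d %| #|K|.-1)%N -> #|[set u : K | u ^+ d == 1]| = d.
Proof.
have q1 : (0 < #|K|.-1)%N by have := finNzRing_gt1 K; case: #|K| => [|[]].
move=> dq; have d0 := dvdn_gt0 q1 dq.
have [g gP] := exists_prim_root.
have hP := dvdn_prim_root gP dq.
set h := g ^+ _ in hP.
transitivity #|[set h ^+ i | i : 'I_d]|.
  apply: eq_card => u; rewrite inE; apply/eqP/imsetP => [/(prim_rootP hP)[i ->]|[i _ ->]].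
    by exists i.
  by rewrite exprAC (prim_expr_order hP) expr1n.
rewrite card_imset ?card_ord // => i j /eqP.
by rewrite (eq_prim_root_expr hP) !modn_small // => /eqP E; exact: val_inj.
Qed.

(** K^* is cyclic of order d e, so the kernel of the e-th power map is the
image of the d-th power map. *)
Lemma exists_root d e (a : K) : a != 0 -> #|K|.-1 = (d * e)%N -> a ^+ e = 1 ->
  exists c, c ^+ d = a.
Proof.
have q1 : (0 < #|K|.-1)%N by have := finNzRing_gt1 K; case: #|K| => [|[]].
move=> a0 qE ae; have [g gP] := exists_prim_root.
have [[i /= _] aE] := prim_rootP gP (expf_card1 a0).
have e0 : (0 < e)%N by move: q1; rewrite qE muln_gt0 => /andP[].
move: ae; rewrite aE -exprM => /eqP; rewrite -(prim_order_dvd gP) qE.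
rewrite dvdn_pmul2r // => /dvdnP[k ->].
by exists (g ^+ k); rewrite -exprM.
Qed.

End RootCounts.

(** * Additive characters and points of y^p - y = f(x) *)

Section Characters.
Variables (p m : nat) (K : finFieldType).
Hypotheses (p_prime : prime p) (cardK : #|K| = (p ^ m)%N).

Lemma m_gt0 : (0 < m)%N.
Proof. by have := finNzRing_gt1 K; rewrite cardK; case: m => //; rewrite expn0. Qed.

Lemma pcharK : p \in [pchar K].
Proof. exact: card_finPcharP cardK p_prime. Qed.

Lemma frob_powD k (x y : K) : (x + y) ^+ (p ^ k) = x ^+ (p ^ k) + y ^+ (p ^ k).
Proof.
apply: exprDn_pchar; rewrite (eq_pnat _ (pcharf_eq pcharK)).
by rewrite pnatX pnat_id // orbT.
Qed.

Lemma frob_powN k (x : K) : (- x) ^+ (p ^ k) = - x ^+ (p ^ k).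
Proof.
apply/eqP; rewrite -addr_eq0 -frob_powD addNr expr0n expn_eq0.
by have := prime_gt0 p_prime; case: p.
Qed.

Lemma frob_powB k (x y : K) : (x - y) ^+ (p ^ k) = x ^+ (p ^ k) - y ^+ (p ^ k).
Proof. by rewrite frob_powD frob_powN. Qed.

Lemma frob_pow_inj k : injective (fun x : K => x ^+ (p ^ k)).
Proof.
move=> x y /= /eqP; rewrite -subr_eq0 -frob_powB expf_eq0 => /andP[_].
by rewrite subr_eq0 => /eqP.
Qed.

Lemma frob_pow_sum k I (r : seq I) (P : pred I) (F : I -> K) :
  (\sum_(i <- r | P i) F i) ^+ (p ^ k) = \sum_(i <- r | P i) F i ^+ (p ^ k).
Proof.
elim/big_rec2: _ => [|i x y _ <-]; last exact: frob_powD.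
by rewrite expr0n expn_eq0; have := prime_gt0 p_prime; case: p.
Qed.

Lemma natr_eq_mod (i j : nat) : i%:R = j%:R :> K -> i = j %[mod p].
Proof.
wlog ij : i j / (i <= j)%N => [H E|].
  by case/orP: (leq_total i j) => /H H'; [exact: H'|exact/esym/H'].
move=> E; symmetry; apply/eqP; rewrite eqn_mod_dvd // (dvdn_pcharf pcharK).
by rewrite natrB // E subrr.
Qed.

Lemma XpX_neq0 : 'X^p - 'X != 0 :> {poly K}.
Proof.
have p1 := prime_gt1 p_prime.
by rewrite -size_poly_eq0 size_polyDl ?size_polyXn ?size_polyN ?size_polyX.
Qed.

Lemma prime_field : [set b : K | b ^+ p == b] = [set (k%:R : K) | k : 'I_p].
Proof.
have p1 := prime_gt1 p_prime.
apply/esym/eqP; rewrite eqEcard; apply/andP; split.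
  apply/subsetP => _ /imsetP[k _ ->]; rewrite inE.
  by rewrite -(pFrobenius_autE pcharK) rmorph_nat.
rewrite (@card_imset _ _ (fun k : 'I_p => k%:R : K)) ?card_ord; last first.
  by move=> i j /natr_eq_mod; rewrite !modn_small // => /val_inj.
rewrite -ltnS; have := card_roots XpX_neq0.
rewrite size_polyDl ?size_polyXn ?size_polyN ?size_polyX // => H.
apply: leq_ltn_trans H; apply/subset_leq_card/subsetP => x.
by rewrite !inE rootE !hornerE subr_eq0.
Qed.

Lemma natr_fixed (x : K) : x ^+ p = x -> exists k : 'I_p, x = k%:R.
Proof.
move=> /eqP xp; have : x \in [set b : K | b ^+ p == b] by rewrite inE.
by rewrite prime_field => /imsetP[k _ ->]; exists k.
Qed.

Lemma card_prime_field : #|[set b : K | b ^+ p == b]| = p.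
Proof.
rewrite prime_field (@card_imset _ _ (fun k : 'I_p => k%:R : K)) ?card_ord //.
by move=> i j /natr_eq_mod; rewrite !modn_small // => /val_inj.
Qed.

(** The character x |-> z ^ Tr(x), with z a primitive p-th root of unity and the
trace to the prime field read as an integer in [0, p).  Its invariance under
Frobenius is that of the trace. *)
Lemma exists_additive_character : exists psi : K -> algC,
  [/\ psi 0 = 1, forall x y, psi (x + y) = psi x * psi y,
      forall x, psi (x ^+ p) = psi x
    & exists x, psi x != 1].
Proof.
have p1 := prime_gt1 p_prime; have p0 := prime_gt0 p_prime.
have [z zP] := C_prim_root_exists p0.
pose Tr (x : K) := \sum_(i < m) x ^+ (p ^ i).
have TrF x : Tr (x ^+ p) = Tr x.
  rewrite /Tr; have := m_gt0; case: m cardK => // m' cK _.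
  rewrite big_ord_recr [RHS]big_ord_recl /= addrC expn0 expr1.
  rewrite -exprM -expnS -cK expf_card; congr (_ + _).
  by apply: eq_bigr => i _; rewrite -exprM -expnS.
have TrD x y : Tr (x + y) = Tr x + Tr y.
  by rewrite -big_split /=; apply: eq_bigr => i _; rewrite frob_powD.
have Trp x : exists k : 'I_p, Tr x == k%:R.
  case: (@natr_fixed (Tr x)); last by move=> k ->; exists k.
  rewrite -[X in _ ^+ X]expn1 frob_pow_sum -[RHS]TrF; apply: eq_bigr => i _.
  by rewrite expn1 exprAC.
pose lam x := xchoose (Trp x).
have lamP x : Tr x = (lam x)%:R by apply/eqP/(xchooseP (Trp x)).
have lamE x (k : nat) : Tr x = k%:R -> z ^+ (lam x) = z ^+ k.
  rewrite lamP => /natr_eq_mod E.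
  by apply/eqP; rewrite (eq_prim_root_expr zP); apply/eqP.
exists (fun x => z ^+ lam x); split.
- rewrite (@lamE 0 0) ?expr0 // /Tr big1 // => i _.
  by rewrite expr0n expn_eq0 (gtn_eqF p0).
- by move=> x y; rewrite -exprD; apply: lamE; rewrite TrD natrD -!lamP.
- by move=> x; apply: lamE; rewrite TrF lamP.
(* The trace is a nonzero polynomial of degree p ^ m.-1, less than #|K|. *)
pose P : {poly K} := \sum_(i < m) 'X^(p ^ i).
have P0 : P != 0.
  apply/eqP => /polyP/(_ 1%N); rewrite coef0 coef_sum.
  have [m' mE] : exists m', m = m'.+1 by case: m m_gt0 => // m'; exists m'.
  rewrite mE big_ord_recl expn0 coefXn eqxx big1 ?addr0; last first.
    move=> i _; rewrite coefXn -(expn0 p) eqn_exp2l //.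
  by move/eqP; rewrite oner_eq0.
have szP : (size P <= (p ^ m.-1).+1)%N.
  apply: leq_trans (size_sum _ _ _) _; apply/bigmax_leqP => i _.
  rewrite size_polyXn ltnS leq_pexp2l // -ltnS prednK ?m_gt0 //.
have [x Px] : exists x, ~~ root P x.
  apply/existsP; rewrite -negb_forall; apply/negP => /forallP H.
  have := leq_trans (card_roots P0) szP; rewrite ltnS leqNgt => /negP; apply.
  rewrite (eq_card (_ : _ =i predT)); last by move=> x; rewrite !inE H.
  rewrite [#|_|]cardK ltn_exp2l // prednK ?m_gt0 //.
exists x; apply: contra Px => /eqP E; rewrite rootE horner_sum.
have -> : \sum_(i < m) ('X^(p ^ i)).[x] = Tr x.
  by apply: eq_bigr => i _; rewrite hornerXn.
move/eqP: E; rewrite -(prim_order_dvd zP) lamP => d.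
by rewrite -(dvdn_pcharf pcharK).
Qed.

End Characters.

Section CharacterSums.
Variables (p m : nat) (K : finFieldType).
Hypotheses (p_prime : prime p) (cardK : #|K| = (p ^ m)%N).
Variable psi : K -> algC.

Hypotheses (psi0 : psi 0 = 1) (psiD : forall x y, psi (x + y) = psi x * psi y)
  (psi_frob : forall x, psi (x ^+ p) = psi x)
  (psi_nontriv : exists x, psi x != 1).

Lemma psi_frobX k x : psi (x ^+ (p ^ k)) = psi x.
Proof.
elim: k x => [|k IH] x; first by rewrite expn0.
by rewrite expnSr exprM psi_frob IH.
Qed.

Lemma psi_mulrn x k : psi (x *+ k) = psi x ^+ k.
Proof. by elim: k => [|k IH]; rewrite ?mulr0n ?psi0 // mulrS exprS psiD IH. Qed.

Lemma psi_expp x : psi x ^+ p = 1.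
Proof. by rewrite -psi_mulrn (mulrn_pchar (pcharK p_prime cardK)) psi0. Qed.

Lemma sum_psi b : \sum_x psi (b * x) = if b == 0 then #|K|%:R else 0.
Proof.
case: eqP => [->|/eqP b0].
  rewrite (eq_bigr (fun=> 1)) => [|x _]; last by rewrite mul0r psi0.
  by rewrite sumr_const.
have [c c1] := psi_nontriv.
have cb : psi (b * (c / b)) != 1 by rewrite mulrCA divff ?mulr1.
have : (psi (b * (c / b)) - 1) * \sum_x psi (b * x) = 0.
  rewrite mulrBl mul1r mulr_sumr [X in _ - X](reindex_inj (addrI (c / b))) /=.
  by rewrite -sumrB big1 // => x _; rewrite mulrDr psiD subrr.
by move/eqP; rewrite mulf_eq0 subr_eq0 (negPf cb) => /eqP.
Qed.

(** A dual variable b detects the equation by orthogonality.  Summing over y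
first leaves \sum_y psi((b^p - b) y^p), because psi(b y) = psi(b^p y^p); so only
the b in the prime field contribute. *)
Lemma count_artin_schreier (f : K -> K) :
  #|[set u : K * K | u.2 ^+ p - u.2 == f u.1]|%:R =
    \sum_(b | b ^+ p == b) \sum_x psi (b * f x).
Proof.
have q0 : #|K|%:R != 0 :> algC by rewrite pnatr_eq0 -lt0n; apply/card_gt0P; exists 0.
apply: (mulfI q0).
rewrite -sum1_card natr_sum mulr_sumr.
transitivity (\sum_(u : K * K) \sum_b psi ((f u.1 - (u.2 ^+ p - u.2)) * b)).
  rewrite [LHS]big_mkcond /=; apply: eq_bigr => u _; rewrite inE sum_psi subr_eq0 eq_sym.
  by case: ifP; rewrite ?mulr1 ?mulr0.
rewrite exchange_big /= mulr_sumr [RHS]big_mkcond; apply: eq_bigr => b _ /=.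
rewrite -(pair_bigA _ (fun x y => psi ((f x - (y ^+ p - y)) * b))) /=.
transitivity (\sum_x psi (b * f x) * \sum_y psi ((b ^+ p - b) * y ^+ p)).
  apply: eq_bigr => x _; rewrite mulr_sumr; apply: eq_bigr => y _.
  rewrite opprB mulrDl mulrBl [b * _]mulrC !psiD; congr (_ * _).
  rewrite mulrBl psiD; congr (_ * _); last by rewrite -mulNr -mulrN mulrC.
  by rewrite -psi_frob exprMn mulrC.
have inj : injective (fun y : K => y ^+ p).
  by move=> x y E; apply: (frob_pow_inj p_prime cardK (k := 1)); rewrite /= expn1.
rewrite -mulr_suml -(reindex_inj inj (P := predT) (F := fun y => psi ((b ^+ p - b) * y))).
rewrite sum_psi subr_eq0; case: ifP; rewrite ?mulr0 // mulrC //.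
Qed.

End CharacterSums.

(** * Integer arithmetic *)

Lemma odd_pow_gt2 (p l : nat) : prime p -> odd p -> (0 < l)%N -> (2 < p ^ l)%N.
Proof.
move=> p_prime p_odd l_gt0.
have p2 : (2 < p)%N by rewrite odd_prime_gt2.
by apply: (leq_trans p2); rewrite -{1}(expn1 p) leq_exp2l //; exact: ltnW.
Qed.

(** The square condition leaves s = +-p^j.  As p^l = -1 modulo p^l + 1, the
congruence forces l to divide j and determines the sign. *)
Lemma sqrt_pow_congr (p l M : nat) (s t : int) (Q := (p ^ l)%N) :
  prime p -> odd p -> (0 < l)%N ->
  s ^+ 2 = (p ^ M)%:R -> s = 1 + Q.+1%:R * t ->
  exists2 k, s = (- Q%:R) ^+ k & (2 * (l * k) = M)%N.
Proof.
move=> p_prime p_odd l_gt0 s2 sE.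
have Q2 := odd_pow_gt2 p_prime p_odd l_gt0; rewrite -/Q in Q2.
have p1 := prime_gt1 p_prime.
have s2n : (`|s| ^ 2 = p ^ M)%N by rewrite -abszX s2 natz.
have [j _ jE] : exists2 j, (j <= M)%N & `|s|%N = (p ^ j)%N.
  by apply/(dvdn_pfactor _ _ p_prime); rewrite -s2n expnS dvdn_mulr.
have jM : (2 * j = M)%N.
  apply/eqP; rewrite -(eqn_exp2l _ _ p1) -s2n jE -expnM mulnC //.
pose k := (j %/ l)%N; pose r := (j %% l)%N.
have jkr : j = (l * k + r)%N by rewrite /k /r mulnC -divn_eq.
have rl : (r < l)%N by rewrite ltn_mod.
have prQ : (p ^ r < Q)%N by rewrite ltn_exp2l.
have sg : s = Num.sg s * (Q%:R ^+ k * (p ^ r)%:R).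
  by rewrite {1}[s]numEsg -abszE jE jkr expnD expnM -/Q -natrX -natrM natz.
have dQ : (Q.+1%:Z %| Q%:R ^+ k - (-1) ^+ k)%Z.
  by rewrite subrXX; apply: dvdz_mulr; rewrite opprK -natz -addn1 natrD dvdzz.
have d1 : (Q.+1%:Z %| Num.sg s * (-1) ^+ k * (p ^ r)%:R - 1)%Z.
  have -> : Num.sg s * (-1) ^+ k * (p ^ r)%:R - 1 = (s - 1) - 
     (Q%:R ^+ k - (-1) ^+ k) * (Num.sg s * (p ^ r)%:R) by rewrite {2}sg; ring.
  rewrite rpredB // ?dvdz_mulr //.
  by rewrite sE addrAC subrr add0r natz dvdz_mulr.
have s0 : s != 0 by rewrite -absz_eq0 jE expn_eq0 (gtn_eqF (prime_gt0 p_prime)).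
(* As 0 < p^r + 1 < Q + 1, the congruence d1 excludes the value -1; then it
   gives p^r = 1. *)
have sgE : Num.sg s * (-1) ^+ k = 1 \/ Num.sg s * (-1) ^+ k = -1.
  rewrite -signr_odd; case: sgzP s0 => // _ _; case: (odd k); rewrite ?expr1 ?expr0;
  by [left|right].
have p0 : (0 < p ^ r)%N by rewrite expn_gt0 prime_gt0.
case: sgE => sgE; rewrite sgE in d1; last first.
  have : (Q.+1 %| (p ^ r).+1)%N.
    by move: d1; rewrite mulN1r -opprD natz rpredN -PoszD addn1.
  by move/dvdn_leq => /(_ isT); rewrite ltnS leqNgt prQ.
have pr1 : (p ^ r = 1)%N.
  move: d1; rewrite mul1r natz -(prednK p0) -addn1 PoszD addrK.
  rewrite dvdzE /= => /dvdnP[[|c]]; first by rewrite mul0n => ->.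
  move=> E; have : ((p ^ r).-1 < Q.+1)%N by rewrite ltnS (leq_trans (leq_pred _)) // ltnW.
  by rewrite E mulSn ltnNge leq_addr.
have r0 : r = 0%N by apply/eqP; rewrite -(eqn_exp2l _ _ p1) pr1 expn0.
exists k; last by rewrite -jM jkr r0 addn0.
have sgk : Num.sg s = (-1) ^+ k.
  apply: (mulIf (x := (-1) ^+ k)); first by rewrite signr_eq0.
  by rewrite sgE -expr2 sqrr_sign.
by rewrite {1}sg sgk pr1 mulr1 [in RHS]exprNn.
Qed.

(** The numerical end of the moment argument.  Here a = (-Q)^n, J is the number of
affine points common to the two Hermitian equations, and N the number of g1 for
which (g1, 0) has a radical of order Q^6.  The equation evaluates the sum of
(T-1)(T+Q)(T-Q^2) in two ways, and the preceding hypothesis is the second moment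
along the line g2 = 0. *)
Lemma moment_contradiction (Q a J N : int) :
  3 <= Q -> Q ^+ 4 <= `|a| -> 0 <= J -> J <= Q ^+ 3 + Q ^+ 2 ->
  N * Q ^+ 6 + a ^+ 2 <= 1 + (a ^+ 2 - 1) * (Q ^+ 3 + 1) ->
  a * (1 + (a ^+ 2 - 1) * (Q + 1) + (a ^+ 2 - 1) * J)
    - (Q ^+ 2 - Q + 1) * (a ^+ 2 * (1 + (a ^+ 2 - 1) * (Q + 1)))
    - Q * (Q ^+ 2 - Q + 1) * a ^+ 3 + Q ^+ 3 * a ^+ 4
  = (a - 1) * (a + Q) * (a - Q ^+ 2)
    - (Q ^+ 3 + 1) * (Q ^+ 3 - Q) * (Q ^+ 3 + Q ^+ 2) * N -> False.
Proof.
move=> Q3 aQ J0 JQ HN E.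
pose X := (a - Q ^+ 2) * (a + Q) - a * (J - Q ^+ 3 + Q).
pose c := (Q ^+ 3 + 1) * (Q ^+ 2 - 1) * (Q + 1).
have Qge1 : 1 <= Q by rewrite (le_trans _ Q3).
have Qge0 : 0 <= Q by rewrite (le_trans _ Q3).
have Q0 : 0 < Q ^+ 3 by rewrite exprn_gt0 // (lt_le_trans _ Q3).
(* The hypothesis is divisible by a^2 - 1. *)
have E2 : (a ^+ 2 - 1) * X = c * (Q ^+ 3 * N).
  rewrite /X /c; apply/eqP; rewrite -subr_eq0; apply/eqP.
  move/eqP: E; rewrite -subr_eq0 => /eqP E; rewrite -[RHS]oppr0 -E; ring.
have N1 : Q ^+ 3 * N <= a ^+ 2 - 1.
  rewrite -(ler_pM2l Q0).
  have -> : Q ^+ 3 * (Q ^+ 3 * N) = N * Q ^+ 6 by ring.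
  have -> : Q ^+ 3 * (a ^+ 2 - 1) = 1 + (a ^+ 2 - 1) * (Q ^+ 3 + 1) - a ^+ 2 by ring.
  by rewrite lerBrDr.
have c0 : 0 <= c.
  by rewrite /c !mulr_ge0 ?subr_ge0 ?exprn_ege1 // addr_ge0 // ltW.
have a1 : 0 < a ^+ 2 - 1.
  have : 3 ^+ 4 <= `|a| by rewrite (le_trans _ aQ) // lerXn2r // nnegrE.
  by move=> a4; rewrite subr_gt0 -real_normK ?num_real // exprn_egt1 // (lt_le_trans _ a4).
have Xc : X <= c by rewrite -(ler_pM2l a1) E2 mulrC ler_wpM2r.
suff : c < X by rewrite ltNge Xc.
have Qk k : (k <= 6)%N -> Q ^+ k <= Q ^+ 6 by move=> k6; rewrite ler_weXn2l.
have Q6 : 0 < Q ^+ 6 by rewrite exprn_gt0 // (lt_le_trans _ Q3).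
have Q7 : 3 * Q ^+ 6 <= Q ^+ 7 by rewrite [Q ^+ 7]exprS ler_wpM2r // ltW.
have Q8 : 3 * Q ^+ 7 <= Q ^+ 8 by rewrite [Q ^+ 8]exprS ler_wpM2r // exprn_ge0.
have := (Qk 2%N isT, Qk 3%N isT, Qk 5%N isT) => -[[q2 q3] q5].
have cb : c <= (Q ^+ 3 + 1) * (Q ^+ 3 + Q ^+ 2).
  rewrite -subr_ge0 /c (_ : _ - _ = (Q ^+ 3 + 1) * (Q + 1)); last by ring.
  by rewrite mulr_ge0 // addr_ge0 // ltW // (lt_le_trans _ Q3).
(* X is at least |a| (|a| - Q^3 + Q^2) - Q^3 or |a| (|a| - 2 Q^2) - Q^3,
   according to the sign of a; both have order Q^8, whereas c has order Q^6. *)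
apply: le_lt_trans cb _; move: aQ; set A := `|a| => aQ.
have Q40 : 0 <= Q ^+ 4 by rewrite exprn_ge0 // (le_trans _ Q3).
case: (lerP 0 a) => [a_ge0|a_lt0].
  have aA : a = A by rewrite /A ger0_norm.
  have X1 : A * (A - 2 * Q ^+ 2) - Q ^+ 3 <= X.
    rewrite -subr_ge0 /X aA.
    have -> : (A - Q ^+ 2) * (A + Q) - A * (J - Q ^+ 3 + Q) - (A * (A - 2 * Q ^+ 2) - Q ^+ 3)
      = A * (Q ^+ 3 + Q ^+ 2 - J) by ring.
    by rewrite mulr_ge0 // ?subr_ge0 // -aA.
  apply: lt_le_trans X1.
  have X2 : Q ^+ 4 * (Q ^+ 4 - 2 * Q ^+ 2) <= A * (A - 2 * Q ^+ 2).
    apply: ler_pM => //; last by rewrite lerB.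
    have -> : Q ^+ 4 - 2 * Q ^+ 2 = Q ^+ 2 * (Q ^+ 2 - 1 - 1) by ring.
    rewrite mulr_ge0 ?exprn_ge0 // -addrA -opprD subr_ge0.
    by rewrite (le_trans _ (lerXn2r 2 _ _ Q3)) // nnegrE.
  apply: lt_le_trans (lerB X2 (lexx _)); rewrite -subr_gt0.
  have -> : Q ^+ 4 * (Q ^+ 4 - 2 * Q ^+ 2) - Q ^+ 3 - (Q ^+ 3 + 1) * (Q ^+ 3 + Q ^+ 2)
    = Q ^+ 8 - 3 * Q ^+ 6 - Q ^+ 5 - 2 * Q ^+ 3 - Q ^+ 2 by ring.
  clear -q2 q3 q5 Q6 Q7 Q8; lra.
have aA : a = - A by rewrite /A ltr0_norm // opprK.
have X1 : A * (A + Q ^+ 2 - Q ^+ 3) - Q ^+ 3 <= X.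
  rewrite -subr_ge0 /X aA.
  have -> : (- A - Q ^+ 2) * (- A + Q) - (- A) * (J - Q ^+ 3 + Q)
      - (A * (A + Q ^+ 2 - Q ^+ 3) - Q ^+ 3) = A * J by ring.
  by rewrite mulr_ge0 // normr_ge0.
apply: lt_le_trans X1.
have X2 : Q ^+ 4 * (Q ^+ 4 + Q ^+ 2 - Q ^+ 3) <= A * (A + Q ^+ 2 - Q ^+ 3).
  apply: ler_pM => //; last by rewrite lerB // lerD.
  have -> : Q ^+ 4 + Q ^+ 2 - Q ^+ 3 = Q ^+ 3 * (Q - 1) + Q ^+ 2 by ring.
  by rewrite addr_ge0 ?mulr_ge0 ?exprn_ge0 // subr_ge0.
apply: lt_le_trans (lerB X2 (lexx _)); rewrite -subr_gt0.
have -> : Q ^+ 4 * (Q ^+ 4 + Q ^+ 2 - Q ^+ 3) - Q ^+ 3 - (Q ^+ 3 + 1) * (Q ^+ 3 + Q ^+ 2)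
  = Q ^+ 8 - Q ^+ 7 - Q ^+ 5 - 2 * Q ^+ 3 - Q ^+ 2 by ring.
clear -q2 q3 q5 Q6 Q7 Q8; lra.
Qed.

(** * Hermitian exponential sums *)

Section Family.
Variables (p l n : nat) (K : finFieldType).
Hypotheses (p_prime : prime p) (p_odd : odd p) (l_gt0 : (0 < l)%N).
Let Q := (p ^ l)%N.
Hypothesis cardK : #|K| = (Q ^ (2 * n))%N.
Variable psi : K -> algC.
Hypotheses (psi0 : psi 0 = 1) (psiD : forall x y, psi (x + y) = psi x * psi y)
  (psi_frob : forall x, psi (x ^+ p) = psi x)
  (psi_nontriv : exists x, psi x != 1).

Let cardKp : #|K| = (p ^ (l * (2 * n)))%N.
Proof. by rewrite cardK /Q -expnM. Qed.

Let Qgt2 : (2 < Q)%N := odd_pow_gt2 p_prime p_odd l_gt0.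
Let Qgt0 : (0 < Q)%N := ltnW (ltnW Qgt2).
Let QX0 k : (Q ^ k == 0)%N = false.
Proof. by rewrite gtn_eqF // expn_gt0 Qgt0. Qed.
Let QleQ2 : (Q <= Q ^ 2)%N.
Proof. by rewrite expnS expn1 leq_pmulr. Qed.

Lemma expQD k (x y : K) : (x + y) ^+ (Q ^ k) = x ^+ (Q ^ k) + y ^+ (Q ^ k).
Proof. by rewrite /Q -expnM (frob_powD p_prime cardKp). Qed.

Lemma expQN k (x : K) : (- x) ^+ (Q ^ k) = - x ^+ (Q ^ k).
Proof. by rewrite /Q -expnM (frob_powN p_prime cardKp). Qed.

Lemma expQ_inj k : injective (fun x : K => x ^+ (Q ^ k)).
Proof. by rewrite /Q -expnM; exact: frob_pow_inj p_prime cardKp _. Qed.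

Lemma psiQ k x : psi (x ^+ (Q ^ k)) = psi x.
Proof. by rewrite /Q -expnM psi_frobX. Qed.

Lemma predq_factor : exists M, #|K|.-1 = (Q.+1 * (Q.-1 * M))%N.
Proof.
rewrite cardK expnM predn_exp; eexists; rewrite mulnA; congr (_ * _)%N.
rewrite -subn1 -(exp1n 2) subn_sqr mulnC addn1 subn1 //.
Qed.

Lemma norm_surj (b : K) : b ^+ Q = b -> exists c, c ^+ Q.+1 = b.
Proof.
move=> bQ; have [->|b0] := eqVneq b 0; first by exists 0; rewrite expr0n.
have [M qE] := predq_factor; apply: (exists_root b0 qE).
rewrite exprM; suff -> : b ^+ Q.-1 = 1 by rewrite expr1n.
by apply: (mulfI b0); rewrite -exprS prednK ?bQ ?mulr1 // ltnW // ltnW.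
Qed.

Lemma card_norm1 : #|[set u : K | u ^+ Q.+1 == 1]| = Q.+1.
Proof. by have [M qE] := predq_factor; apply: card_unity; rewrite qE dvdn_mulr. Qed.

Lemma card_norm_fibre (x : K) : x != 0 -> #|[set y : K | y ^+ Q.+1 == x ^+ Q.+1]| = Q.+1.
Proof.
move=> x0; rewrite -[RHS]card_norm1 -[RHS](card_imset _ (mulfI x0)).
apply: eq_card => y; rewrite inE; apply/eqP/imsetP => [E|[u]].
  exists (y / x); last by rewrite mulrCA divff ?mulr1.
  by rewrite inE exprMn exprVn E divff ?expf_neq0.
by rewrite inE => /eqP u1 ->; rewrite exprMn u1 mulr1.
Qed.

Let Qm := (Q ^ 2 - Q + 1)%N.
(** It makes x^(Q^3+1) a power of the norm x^(Q+1). *)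
Lemma Q3_factor : (Q ^ 3 + 1 = Q.+1 * Qm)%N.
Proof.
rewrite /Qm; move: (Q : nat) QleQ2 => N H; nia.
Qed.

Lemma exprQm_fixed (b : K) : b ^+ Q = b -> b ^+ Qm = b.
Proof.
move=> bQ; have [->|b0] := eqVneq b 0; first by rewrite expr0n /Qm addn1.
apply: (mulIf (expf_neq0 Q b0)); rewrite -exprD /Qm -addnA (addnC 1%N) addnA subnK.
  by rewrite expnS expn1 addn1 exprSr exprM !bQ.
exact: QleQ2.
Qed.

Definition hform (g : K * K) (x : K) := g.1 * x ^+ (Q ^ 3 + 1) + g.2 * x ^+ (Q + 1).
Definition hsum g := \sum_x psi (hform g x).
(** The additive polynomial whose zero set is the radical of the polar form
h(y+u) - h(y) - h(u): under psi, Frobenius turns each of the four terms of the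
polar form into a multiple of y^(Q^3). *)
Definition hadj (g : K * K) (u : K) :=
  g.1 ^+ (Q ^ 3) * u ^+ (Q ^ 6) + g.2 ^+ (Q ^ 3) * u ^+ (Q ^ 4)
  + g.2 ^+ (Q ^ 2) * u ^+ (Q ^ 2) + g.1 * u.
Definition hrad (g : K * K) : {set K} := [set u | hadj g u == 0].
Definition hscale (b : K) (g : K * K) := (b * g.1, b * g.2).

Lemma hform_norm g x :
  hform g x = g.1 * (x ^+ Q.+1) ^+ Qm + g.2 * x ^+ Q.+1.
Proof. by rewrite /hform Q3_factor exprM addn1. Qed.

Lemma hformE g x :
  hform g x = g.1 * (x ^+ (Q ^ 3) * x) + g.2 * (x ^+ (Q ^ 1) * x).
Proof. by rewrite /hform !addn1 expn1 !exprSr. Qed.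

Lemma hform_scale b g x : hform (hscale b g) x = b * hform g x.
Proof. by rewrite /hform /hscale /=; ring. Qed.

(** The substitution x -> c x with c^(Q+1) = b multiplies the form by b. *)
Lemma hsum_scale (b : K) g : b ^+ Q = b -> b != 0 -> hsum (hscale b g) = hsum g.
Proof.
move=> bQ b0; have [c cE] := norm_surj bQ.
have c0 : c != 0 by apply: contraNneq b0 => c0; rewrite -cE c0 expr0n.
rewrite /hsum [RHS](reindex_inj (mulfI c0)) /=; apply: eq_bigr => x _.
rewrite !hform_norm /= exprMn cE exprMn (exprQm_fixed bQ); congr psi; ring.
Qed.

Lemma hsumN g : hsum (hscale (-1) g) = hsum g.
Proof.
apply: hsum_scale; last by rewrite oppr_eq0 oner_neq0.
by rewrite -[Q in _ ^+ Q]expn1 expQN expr1n.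
Qed.

Lemma hform_polar g u y : psi (hform g (y + u) - hform g y) =
  psi (hform g u) * psi (hadj g u * y ^+ (Q ^ 3)).
Proof.
transitivity (psi (hform g u + g.1 * u ^+ (Q ^ 3) * y + g.2 * u ^+ (Q ^ 1) * y
     + g.2 * u * y ^+ (Q ^ 1) + g.1 * u * y ^+ (Q ^ 3))).
  by rewrite !hformE !expQD; congr psi; ring.
rewrite !psiD /hadj !mulrDl !psiD -!mulrA; congr (_ * _).
rewrite -(psiQ 3 (g.1 * (_ * _))) -(psiQ 3 (g.2 * (_ * y))) -(psiQ 2 (g.2 * (u * _))).
by rewrite !exprMn -!exprM -!expnD.
Qed.

(** On the radical psi(h(y+u)) = psi(h(y)) psi(h(u)) for all y; take y = -u. *)
Lemma hrad_psi g u : u \in hrad g -> psi (hform g u) = 1.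
Proof.
rewrite inE => /eqP W.
have E y : psi (hform g (y + u) - hform g y) = psi (hform g u).
  by rewrite hform_polar W mul0r psi0 mulr1.
have hN : hform g (- u) = hform g u.
  by rewrite !hformE !expQN; ring.
have := E (- u); rewrite addNr hN; set h := hform g u => E2.
have h0 : hform g 0 = 0 by rewrite /hform !addn1 !expr0n !mulr0 addr0.
have s1 : psi h * psi h = 1.
  by rewrite -{1}E2 h0 add0r -psiD addNr psi0.
(* psi h is both a square root and a p-th root of 1, and p is odd. *)
have := psi_expp p_prime cardKp psi0 psiD h.
rewrite -(odd_double_half p) p_odd exprS -mul2n exprM expr2 s1 expr1n mulr1 //.
Qed.

(** S(g)^2 = S(g) S(-g) is a double sum over x = y + u and y, in which the sum
over y vanishes unless u lies in the radical. *)
Lemma hsum_sqr g : hsum g ^+ 2 = (#|K| * #|hrad g|)%:R.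
Proof.
rewrite expr2 -{2}hsumN /hsum big_distrlr /= exchange_big /=.
transitivity (\sum_y \sum_u psi (hform g (y + u) - hform g y)).
  apply: eq_bigr => y _; rewrite (reindex_inj (addrI y)) /=.
  by apply: eq_bigr => u _; rewrite [RHS]psiD hform_scale mulN1r.
rewrite exchange_big /= mulnC natrM -sum1_card natr_sum mulr_suml [RHS]big_mkcond /=.
apply: eq_bigr => u _.
under eq_bigr => y _ do rewrite hform_polar.
rewrite -mulr_sumr; 
rewrite -(reindex_inj (@expQ_inj 3) (P := predT) (F := fun y => psi (hadj g u * y))).
rewrite (sum_psi psi0 psiD psi_nontriv) inE; case: eqP => W0; last by rewrite mulr0.
by rewrite hrad_psi ?inE ?W0 ?mul1r.
Qed.

(** The radical is a subgroup of the additive group of K. *)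
Lemma card_hrad g : exists2 e, #|hrad g| = (p ^ e)%N & (e <= l * (2 * n))%N.
Proof.
have gr : group_set (hrad g).
  apply/group_setP; split.
    by rewrite inE /hadj !expr0n !QX0 /= !mulr0 !addr0.
  move=> x y; rewrite !inE => /eqP E1 /eqP E2; apply/eqP; rewrite /hadj.
  rewrite FinRing.zmodMgE !expQD; transitivity (0 + 0 : K); last by rewrite addr0.
  by rewrite -{1}E1 -E2 /hadj; ring.
have : (#|hrad g| %| p ^ (l * (2 * n)))%N.
  rewrite -cardKp -cardsT; exact: (cardSg (subsetT (Group gr))).
by case/(dvdn_pfactor _ _ p_prime) => e; exists e.
Qed.

Lemma prime_fixed_Q (b : K) : b ^+ p = b -> b ^+ Q = b.
Proof.
move=> bp; rewrite /Q; elim: l => [|k IH]; first by rewrite expn0.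
by rewrite expnSr exprM IH bp.
Qed.

Lemma curve_count g :
  #|[set u : K * K | u.2 ^+ p - u.2 == hform g u.1]|%:R =
    #|K|%:R + p.-1%:R * hsum g.
Proof.
rewrite (count_artin_schreier p_prime cardKp psi0 psiD psi_frob psi_nontriv).
rewrite (bigD1 0) /=; last by rewrite expr0n (gtn_eqF (prime_gt0 p_prime)).
congr (_ + _).
  by rewrite (eq_bigr (fun=> 1)) ?sumr_const // => x _; rewrite mul0r psi0.
rewrite (eq_bigr (fun=> hsum g)).
  rewrite sumr_const -[LHS]mulr_natl; congr (_%:R * _).
  transitivity #|[set b : K | b ^+ p == b]|.-1; last first.
    by rewrite (card_prime_field p_prime cardKp).
  rewrite [in RHS](cardsD1 0) inE expr0n (gtn_eqF (prime_gt0 p_prime)) eqxx /=.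
  by apply: eq_card => x; rewrite !inE andbC.
move=> b /andP[/eqP bp b0]; rewrite -(hsum_scale g (prime_fixed_Q bp) b0).
by apply: eq_bigr => x _; rewrite hform_scale.
Qed.

(** S(g) is determined by the number of points of a curve. *)
Lemma hsum_rat g : hsum g \in Crat.
Proof.
have p1 : p.-1%:R != 0 :> algC.
  by rewrite pnatr_eq0 -lt0n -subn1 subn_gt0 prime_gt1.
have -> : hsum g = (#|[set u : K * K | u.2 ^+ p - u.2 == hform g u.1]|%:R - #|K|%:R)
    / p.-1%:R.
  by rewrite curve_count addrAC subrr add0r mulrC mulKf.
by rewrite rpred_div ?rpredB ?rpred_nat.
Qed.

Lemma psi_Aint x : psi x \in Aint.
Proof.
apply: (Aint_unity_root (prime_gt0 p_prime)).
by apply/unity_rootP; exact: (psi_expp p_prime cardKp psi0 psiD).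
Qed.

(** The nonzero x contribute a multiple of Q+1 because h is a function of the
norm x^(Q+1).  The cofactor is an algebraic integer, and rational by
[hsum_rat]. *)
Lemma hsum_int g : exists t : int, hsum g = (1 + Q.+1%:R * t)%:~R.
Proof.
pose A (y : K) := [exists x : K, (x != 0) && (x ^+ Q.+1 == y)].
(* al runs over the nonzero norms, each the norm of Q+1 elements. *)
pose al := \sum_(y | A y) psi (g.1 * y ^+ Qm + g.2 * y).
have E : hsum g = 1 + Q.+1%:R * al.
  rewrite /hsum (bigD1 0) //=; congr (_ + _).
    by rewrite hformE !mulr0 addr0 psi0.
  rewrite (partition_big (fun x => x ^+ Q.+1) A) /=; last first.
    by move=> x x0; apply/existsP; exists x; rewrite x0 eqxx.
  rewrite mulr_sumr; apply: eq_bigr => y /existsP[x /andP[x0 /eqP <-]].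
  rewrite (eq_bigr (fun=> psi (hform g x))) => [|z /andP[_ /eqP zE]].
    rewrite sumr_const -[LHS]mulr_natl hform_norm; congr (_%:R * _).
    rewrite -[RHS](card_norm_fibre x0); apply: eq_card => z.
    rewrite !inE; apply: andb_idl => /eqP zE.
    apply: contraNneq x0 => z0; have := expf_eq0 x Q.+1.
    by rewrite -zE z0 expr0n eqxx /= => <-.
  by rewrite !hform_norm zE.
have Q1 : Q.+1%:R != 0 :> algC by rewrite pnatr_eq0.
have alE : al = (hsum g - 1) / Q.+1%:R.
  by rewrite E addrAC subrr add0r mulrC mulKf.
have : al \in Num.int.
  apply: Cint_rat_Aint.
    by rewrite alE rpred_div ?rpredB ?rpred1 ?rpred_nat ?hsum_rat.
  by apply: rpred_sum => y _; exact: psi_Aint.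
by case/intrP => t tE; exists t; rewrite E tE rmorphD rmorphM rmorph1 rmorph_nat.
Qed.

(** The exponent n + d is the k of [sqrt_pow_congr]; it is at least n since the
radical is nonempty. *)
Lemma hsum_value g : exists d,
  hsum g = (((- Q%:R) ^+ n * (- Q%:R) ^+ d : int)%:~R : algC)
  /\ #|hrad g| = (Q ^ (2 * d))%N.
Proof.
have [t tE] := hsum_int g; have [e eE _] := card_hrad g.
set s := 1 + _ in tE.
have s2 : s ^+ 2 = (p ^ (l * (2 * n) + e))%:R.
  apply: (@intr_inj algC); rewrite rmorphXn /= -tE hsum_sqr cardKp eE -expnD.
  by rewrite rmorph_nat.
have [k sk kE] := sqrt_pow_congr p_prime p_odd l_gt0 s2 (erefl s).
have nk : (n <= k)%N.
  have : (2 * l * n <= 2 * l * k)%N by rewrite -!mulnA kE mulnCA leq_addr.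
  by rewrite leq_pmul2l // muln_gt0.
exists (k - n)%N; split; first by rewrite -exprD subnKC // -sk.
rewrite eE /Q -expnM; congr (_ ^ _)%N.
by rewrite !mulnBr [(l * (2 * k))%N]mulnCA kE addKn.
Qed.

Definition hadj_poly (g : K * K) : {poly K} :=
  g.1 ^+ (Q ^ 3) *: 'X^(Q ^ 6) + g.2 ^+ (Q ^ 3) *: 'X^(Q ^ 4)
  + g.2 ^+ (Q ^ 2) *: 'X^(Q ^ 2) + g.1 *: 'X.

Lemma card_hrad_le g k : g != (0, 0) -> (size (hadj_poly g) <= (Q ^ (2 * k)).+1)%N ->
  (#|hrad g| <= Q ^ (2 * k))%N.
Proof.
move=> g0 sz; have Q1 : (1 < Q)%N by rewrite ltnW.
have P0 : hadj_poly g != 0.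
  apply/eqP => /polyP P0; case/negP: g0.
  have eqX (i j : nat) : (Q ^ i == Q ^ j)%N = (i == j) by rewrite eqn_exp2l.
  have g10 : g.1 = 0.
    have := P0 1%N; rewrite !coefD !coefZ !coefXn coefX coef0 -(expn0 Q) !eqX /=.
    by rewrite !mulr0 !add0r mulr1.
  have := P0 (Q ^ 2)%N; rewrite !coefD !coefZ !coefXn coef0 !eqX /= g10.
  rewrite mul0r !mulr0 !mulr1 !add0r addr0 => /eqP; rewrite expf_eq0 => /andP[_ /eqP].
  by move: g10; case: g {P0 sz} => /= ? ? -> ->.
rewrite -ltnS; apply: leq_trans sz.
apply: leq_ltn_trans (card_roots P0); apply/subset_leq_card/subsetP => u.
by rewrite !inE rootE !hornerE.
Qed.

Lemma size_hadj_poly g : (size (hadj_poly g) <= (Q ^ 6).+1)%N.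
Proof.
have H c k : (k <= 6)%N -> (size (c *: 'X^(Q ^ k) : {poly K}) <= (Q ^ 6).+1)%N.
  move=> k6; apply: leq_trans (size_scale_leq _ _) _.
  by rewrite size_polyXn ltnS leq_pexp2l.
have HX c : (size (c *: 'X : {poly K}) <= (Q ^ 6).+1)%N.
  by have := H c 0%N isT; rewrite expn0 expr1.
by do ![apply: leq_trans (size_polyD _ _) _; rewrite geq_max; apply/andP; split];
  [apply: H..|apply: HX].
Qed.

Lemma size_hadj_poly0 (b : K) : (size (hadj_poly (0%R, b)) <= (Q ^ 4).+1)%N.
Proof.
have H c k : (k <= 4)%N -> (size (c *: 'X^(Q ^ k) : {poly K}) <= (Q ^ 4).+1)%N.
  move=> k6; apply: leq_trans (size_scale_leq _ _) _.
  by rewrite size_polyXn ltnS leq_pexp2l.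
rewrite /hadj_poly /= expr0n QX0 !scale0r add0r addr0.
by do ![apply: leq_trans (size_polyD _ _) _; rewrite geq_max; apply/andP; split]; apply: H.
Qed.

(** Let P = (x, y, 1), and let P_i be its image under the Q^i-th power map.  The
hypotheses and their conjugates say that P and P_2 are both orthogonal to P_1 and
P_3, hence to P_1 - P_3, whose last coordinate is 0.  If that vector vanishes,
P = P_2.  Otherwise (x, y) and its image in P_2 are proportional, and the
hypotheses force the ratio to be 1. *)
Lemma hermitian_point (x y : K) :
  x ^+ Q.+1 + y ^+ Q.+1 + 1 = 0 -> x ^+ (Q ^ 3).+1 + y ^+ (Q ^ 3).+1 + 1 = 0 ->
  y ^+ (Q ^ 2) = y.
Proof.
rewrite !exprSr => E1 E3.
have frob k : (x ^+ (Q ^ k)) ^+ Q = x ^+ (Q ^ k.+1) /\ (y ^+ (Q ^ k)) ^+ Q = y ^+ (Q ^ k.+1).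
  by rewrite -!exprM -expnSr.
have E1Q k : x ^+ (Q ^ k.+1) * x ^+ (Q ^ k) + y ^+ (Q ^ k.+1) * y ^+ (Q ^ k) + 1 = 0.
  have : (x ^+ Q * x + y ^+ Q * y + 1) ^+ (Q ^ k) = 0 by rewrite E1 expr0n QX0.
  by rewrite !expQD !exprMn -!exprM -!expnS expr1n.
have := E1Q 0; have := E1Q 1; have := E1Q 2; rewrite expn0 !expr1.
set x1 := x ^+ (Q ^ 1); set x2 := x ^+ (Q ^ 2); set x3 := x ^+ (Q ^ 3) in E3 *.
set y1 := y ^+ (Q ^ 1); set y2 := y ^+ (Q ^ 2); set y3 := y ^+ (Q ^ 3) in E3 *.
move=> F2 F1 F0.
have D : (x * y2 - x2 * y) * (y1 - y3) = 0.
  have e1 : x * (x1 - x3) + y * (y1 - y3) = 0.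
    rewrite -[RHS](subrr (0 : K)) -{1}F0 -E3; ring.
  have e2 : x2 * (x1 - x3) + y2 * (y1 - y3) = 0.
    rewrite -[RHS](subrr (0 : K)) -{1}F1 -F2; ring.
  rewrite -[RHS](subrr (x * 0 - x2 * 0)) -{1}e2 -{1}e1 !mulr0 subr0; ring.
move/eqP: D; rewrite mulf_eq0 => /orP[/eqP D|]; last first.
  rewrite subr_eq0 => /eqP y13; apply: (@expQ_inj 1) => /=.
  by rewrite -exprM -expnD -/y1 y13.
apply/eqP; rewrite -subr_eq0; apply/eqP.
transitivity (y2 * (x1 * x + y1 * y + 1) - y * (x2 * x1 + y2 * y1 + 1)
    - x1 * (x * y2 - x2 * y)); first by ring.
by rewrite F0 F1 D !mulr0 !subr0.
Qed.

(** * Moments of the sums *)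

Lemma sum_line (X : finType) (A : X -> K) :
  \sum_(b : K) \sum_(x : X) psi (b * A x) = (#|K| * #|[set x | A x == 0%R]|)%:R.
Proof.
rewrite exchange_big mulnC natrM -sum1_card natr_sum mulr_suml [RHS]big_mkcond /=.
apply: eq_bigr => x _; rewrite inE mul1r -(sum_psi psi0 psiD psi_nontriv).
by apply: eq_bigr => b _; rewrite mulrC.
Qed.

Lemma sum_plane (X : finType) (A B : X -> K) :
  \sum_(g : K * K) \sum_(x : X) psi (g.1 * A x + g.2 * B x) =
    (#|K| ^ 2 * #|[set x | (A x == 0) && (B x == 0)]|)%:R.
Proof.
rewrite exchange_big mulnC natrM -sum1_card natr_sum mulr_suml [RHS]big_mkcond /=.
apply: eq_bigr => x _; rewrite inE mul1r.
transitivity ((\sum_b psi (A x * b)) * (\sum_b psi (B x * b))).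
  rewrite big_distrlr pair_bigA /=; apply: eq_bigr => g _.
  by rewrite psiD ![g.1 * _]mulrC ![g.2 * _]mulrC.
rewrite !(sum_psi psi0 psiD psi_nontriv).
by case: eqP; case: eqP; rewrite ?mul0r ?mulr0 // -natrM.
Qed.

Lemma card_pairs (X Y : finType) (R : X -> Y -> bool) :
  #|[set u : X * Y | R u.1 u.2]| = (\sum_x #|[set y | R x y]|)%N.
Proof.
rewrite -sum1_card (eq_bigl (fun u => true && R u.1 u.2)) => [|u]; last by rewrite inE.
rewrite -(pair_big_dep xpredT R (fun _ _ => 1%N)) /=.
by apply: eq_bigr => x _; rewrite -sum1_card; apply: eq_bigl => y; rewrite inE.
Qed.

Lemma card_norm_opp (x : K) :
  #|[set y : K | x ^+ Q.+1 + y ^+ Q.+1 == 0]| = if x == 0 then 1%N else Q.+1.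
Proof.
have [w wE] : exists w : K, w ^+ Q.+1 = -1.
  by apply: norm_surj; rewrite -[Q in _ ^+ Q]expn1 expQN expr1n.
have w0 : w != 0.
  by apply/eqP => w0; move/eqP: wE; rewrite w0 expr0n eq_sym oppr_eq0 oner_eq0.
case: eqP => [->|/eqP x0].
  rewrite -[RHS](cards1 (0 : K)); apply: eq_card => y.
  by rewrite !inE expr0n add0r expf_eq0.
rewrite -[RHS](@card_norm_fibre (w * x)) ?mulf_neq0 //; apply: eq_card => y.
by rewrite !inE exprMn wE mulN1r addrC addr_eq0.
Qed.

Lemma sum_nonzero (c0 c1 : nat) :
  (\sum_(x : K) (if x == 0%R then c0 else c1) = c0 + (#|K|.-1) * c1)%N.
Proof.
rewrite (bigD1 0) //= eqxx; congr (_ + _)%N.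
rewrite (eq_bigr (fun=> c1)) => [|x /negPf -> //].
by rewrite sum_nat_const; congr (_ * _)%N; rewrite -(cardC1 (0 : K)); apply: eq_card.
Qed.

(** The exponent Q^2 - Q + 1 that passes from the first norm to the second one is
odd. *)
Lemma norm_opp_pow (x y : K) : x ^+ Q.+1 + y ^+ Q.+1 = 0 ->
  x ^+ (Q ^ 3 + 1) + y ^+ (Q ^ 3 + 1) = 0.
Proof.
move/eqP; rewrite addrC addr_eq0 => /eqP E; rewrite Q3_factor !exprM E.
have oQ : odd Qm by rewrite /Qm addn1 /= oddB // oddX; case: (odd Q).
by rewrite exprNn -signr_odd oQ expr1 mulN1r subrr.
Qed.

Lemma moment1 : \sum_g hsum g = (#|K| ^ 2)%:R.
Proof.
rewrite /hsum sum_plane -[RHS]mulr1 natrM; congr (_ * _).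
rewrite (eq_card (_ : _ =i [set 0])) ?cards1 // => x; rewrite !inE !expf_eq0 /=.
by rewrite !addn1 /= andbb.
Qed.

Lemma moment2 : \sum_g hsum g ^+ 2 = (#|K| ^ 2 * (1 + #|K|.-1 * Q.+1))%:R.
Proof.
transitivity (\sum_g \sum_(u : K * K) psi (g.1 * (u.1 ^+ (Q ^ 3 + 1) + u.2 ^+ (Q ^ 3 + 1))
    + g.2 * (u.1 ^+ Q.+1 + u.2 ^+ Q.+1))).
  apply: eq_bigr => g _; rewrite expr2 /hsum big_distrlr pair_bigA /=.
  by apply: eq_bigr => u _; rewrite -psiD /hform !addn1; congr psi; ring.
rewrite sum_plane; congr (_ * _)%:R.
rewrite -(sum_nonzero 1) -(eq_bigr _ (fun x _ => card_norm_opp x)) -card_pairs.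
apply: eq_card => u; rewrite !inE andb_idl // => /eqP E.
by rewrite norm_opp_pow.
Qed.

(** The common points of the two Hermitian equations, dehomogenised at Z = 1. *)
Definition herm_affine : {set K * K} :=
  [set u | (u.1 ^+ (Q ^ 3 + 1) + u.2 ^+ (Q ^ 3 + 1) + 1 == 0)
           && (u.1 ^+ Q.+1 + u.2 ^+ Q.+1 + 1 == 0)].

(** The solutions with z = 0 are those of the second moment; the others are the
multiples of points with z = 1. *)
Lemma moment3 : \sum_g hsum g ^+ 3 =
  (#|K| ^ 2 * (1 + #|K|.-1 * Q.+1 + #|K|.-1 * #|herm_affine|))%:R.
Proof.
transitivity (\sum_g \sum_(u : K * (K * K))
    psi (g.1 * (u.2.1 ^+ (Q ^ 3 + 1) + u.2.2 ^+ (Q ^ 3 + 1) + u.1 ^+ (Q ^ 3 + 1))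
    + g.2 * (u.2.1 ^+ Q.+1 + u.2.2 ^+ Q.+1 + u.1 ^+ Q.+1))).
  apply: eq_bigr => g _; rewrite exprS expr2 /hsum big_distrlr pair_bigA /=.
  rewrite big_distrlr pair_bigA /=.
  by apply: eq_bigr => u _; rewrite -!psiD /hform !addn1; congr psi; ring.
rewrite sum_plane; congr (_ * _)%:R.
rewrite (card_pairs (fun (z : K) (u : K * K) =>
  (u.1 ^+ (Q ^ 3 + 1) + u.2 ^+ (Q ^ 3 + 1) + z ^+ (Q ^ 3 + 1) == 0)
  && (u.1 ^+ Q.+1 + u.2 ^+ Q.+1 + z ^+ Q.+1 == 0))).
rewrite -sum_nonzero; apply: eq_bigr => z _; case: eqP => [->|/eqP z0].
  rewrite -(sum_nonzero 1) -(eq_bigr _ (fun x _ => card_norm_opp x)) -card_pairs.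
  apply: eq_card => u; rewrite !inE addn1 !expr0n !addr0 andb_idl // => /eqP E.
  by rewrite -addn1 norm_opp_pow.
pose h (u : K * K) := (z * u.1, z * u.2).
have h_inj : injective h by move=> [a b] [c d] [/(mulfI z0) -> /(mulfI z0) ->].
rewrite -[RHS](card_imset _ h_inj); apply: eq_card => -[a b]; rewrite !inE /=.
apply/idP/imsetP => [E|[[c d]]].
  exists (a / z, b / z); last by rewrite /h /= ![z * _]mulrC !divfK.
  rewrite inE /= !expr_div_n.
  have H N : a ^+ N / z ^+ N + b ^+ N / z ^+ N + 1 = (a ^+ N + b ^+ N + z ^+ N) / z ^+ N.
    by rewrite !mulrDl divff ?expf_neq0.
  by rewrite !H !mulf_eq0 !invr_eq0 !expf_eq0 (negPf z0) !andbF !orbF.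
rewrite inE /= => E [-> ->].
have H N : (z * c) ^+ N + (z * d) ^+ N + z ^+ N = (c ^+ N + d ^+ N + 1) * z ^+ N.
  by rewrite !exprMn; ring.
by rewrite !H !mulf_eq0 !expf_eq0 (negPf z0) !andbF !orbF.
Qed.

Lemma card_root_set (P : {poly K}) (A : {set K}) k :
  (size P = k.+1)%N -> (forall x, x \in A -> root P x) -> (#|A| <= k)%N.
Proof.
move=> sz AP; rewrite -ltnS -sz; have P0 : P != 0 by rewrite -size_poly_eq0 sz.
apply: leq_ltn_trans (card_roots P0); apply/subset_leq_card/subsetP => x xA.
by rewrite inE AP.
Qed.

Lemma card_pow_eq_le (c : K) N : (0 < N)%N -> (#|[set x : K | x ^+ N == c]| <= N)%N.
Proof.
move=> N0; apply: (@card_root_set ('X^N - c%:P)); first exact: size_XnsubC.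
by move=> x; rewrite inE rootE !hornerE subr_eq0.
Qed.

(** By [hermitian_point] there are at most Q^2 values of y, and each leaves at most
Q+1 values of x. *)
Lemma card_herm_affine_le : (#|herm_affine| <= Q ^ 3 + Q ^ 2)%N.
Proof.
pose F := [set y : K | y ^+ (Q ^ 2) == y].
have cF : (#|F| <= Q ^ 2)%N.
  have sz : size ('X^(Q ^ 2) - 'X : {poly K}) = (Q ^ 2).+1.
    by rewrite size_polyDl ?size_polyXn // size_polyN size_polyX ltnS (leq_trans (ltnW Qgt2) QleQ2).
  by apply: (card_root_set sz) => y; rewrite inE rootE !hornerE subr_eq0.
apply: (@leq_trans (#|[set v : K * K | (v.1 \in F) &&
    (v.2 ^+ Q.+1 == - (v.1 ^+ Q.+1 + 1))]|)).
  have swap_inj : injective (fun u : K * K => (u.2, u.1)) by move=> [? ?] [? ?] [-> ->].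
  rewrite -(card_imset (mem herm_affine) swap_inj); apply/subset_leq_card/subsetP => v.
  case/imsetP => u; rewrite inE => uH ->; move: uH; rewrite !inE /= addn1.
  move=> /andP[/eqP E3 /eqP E1]; apply/andP; split.
    by apply/eqP; exact: hermitian_point E1 E3.
  by rewrite -addr_eq0 addrA E1.
rewrite (card_pairs (fun y x => (y \in F) && (x ^+ Q.+1 == - (y ^+ Q.+1 + 1)))).
apply: (@leq_trans (\sum_(y in F) Q.+1)).
  rewrite [X in (_ <= X)%N]big_mkcond; apply: leq_sum => y _.
  case: ifP => yF; last by rewrite eq_card0 // => x; rewrite inE.
  by apply: card_pow_eq_le.
rewrite sum_nat_const; apply: leq_trans (leq_mul cF (leqnn _)) _.
by rewrite mulnS addnC -expnSr.
Qed.

(** Each nonzero x has at most Q^3 + 1 partners y in x^(Q^3+1) + y^(Q^3+1) = 0. *)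
Lemma line_moment2 :
  \sum_(b : K) hsum (b, 0) ^+ 2 <= (#|K| * (1 + #|K|.-1 * (Q ^ 3 + 1)))%:R.
Proof.
apply: (@le_trans _ _ (\sum_b \sum_(u : K * K)
    psi (b * (u.1 ^+ (Q ^ 3 + 1) + u.2 ^+ (Q ^ 3 + 1))))).
  rewrite le_eqVlt; apply/orP; left; apply/eqP.
  apply: eq_bigr => b _; rewrite expr2 /hsum big_distrlr pair_bigA /=.
  by apply: eq_bigr => u _; rewrite -psiD /hform /=; congr psi; ring.
rewrite sum_line ler_nat leq_mul2l; apply/orP; right.
rewrite (card_pairs (fun x y : K => x ^+ (Q ^ 3 + 1) + y ^+ (Q ^ 3 + 1) == 0)).
rewrite -sum_nonzero; apply: leq_sum => x _; case: eqP => [->|/eqP x0].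
  rewrite -[X in (_ <= X)%N](cards1 (0 : K)); apply/subset_leq_card/subsetP => y.
  by rewrite !inE addn1 expr0n add0r expf_eq0.
apply: leq_trans (card_pow_eq_le (- x ^+ (Q ^ 3 + 1)) _); last by rewrite addn1.
by apply/subset_leq_card/subsetP => y; rewrite !inE addrC addr_eq0.
Qed.

(** * A form with radical of order Q^6 *)

Lemma hsum0 : hsum (0, 0) = #|K|%:R.
Proof.
rewrite /hsum (eq_bigr (fun=> 1)) ?sumr_const // => x _.
by rewrite /hform /= !mul0r addr0.
Qed.

(** Otherwise d = 3 would occur on the line g2 = 0 only, against
[moment_contradiction]. *)
Lemma exists_hsum : (4 <= n)%N -> exists g : K * K,
  [/\ g.1 != 0, g.2 != 0 & hsum g = (((- Q%:R) ^+ (n + 3) : int)%:~R : algC)].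
Proof.
move=> n4; pose a : int := (- Q%:R) ^+ n.
have [d dP] := fin_all_exists hsum_value.
pose T g : int := (- Q%:R) ^+ d g.
have hT g : hsum g = (a * T g)%:~R by have [] := dP g.
have Q1 : (1 < Q)%N := ltnW Qgt2.
have a2 : a ^+ 2 = #|K|%:R.
  by rewrite -exprM mulnC exprM sqrrN -exprM -natrX -cardK.
have a0 : a != 0 by rewrite expf_neq0 // oppr_eq0 pnatr_eq0 -lt0n.
have q1 : (#|K|.-1)%:R = a ^+ 2 - 1 :> int.
  by rewrite a2 -subn1 natrB // ltnW // finNzRing_gt1.
have d3 g : g != (0, 0) -> (d g <= 3)%N.
  move=> g0; have [_ dg] := dP g.
  have := card_hrad_le g0 (k := 3) (size_hadj_poly g).
  by rewrite dg leq_exp2l // leq_pmul2l.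
have d2 b : b != 0 -> (d (0%R, b) <= 2)%N.
  move=> b0; have [_ dg] := dP (0, b).
  have g0 : (0, b) != (0, 0) :> K * K by rewrite xpair_eqE eqxx.
  have := card_hrad_le g0 (k := 2) (size_hadj_poly0 b).
  by rewrite dg leq_exp2l // leq_pmul2l.
pose P (t : int) := (t - 1) * (t + Q%:R) * (t - Q%:R ^+ 2).
pose c : int := (Q%:R ^+ 3 + 1) * (Q%:R ^+ 3 - Q%:R) * (Q%:R ^+ 3 + Q%:R ^+ 2).
have PT g : g != (0, 0) -> P (T g) = if d g == 3%N then - c else 0.
  move=> /d3; rewrite /P /T; case: (d g) => [|[|[|[|//]]]] _ /=; rewrite /c; ring.
case: (pickP (fun g : K * K => (g.2 != 0) && (d g == 3%N))) => [g /andP[g2 /eqP dg]|none].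
  exists g; split=> //; last by rewrite hT /T dg -exprD.
  apply/eqP => g1; have := d2 _ g2.
  by move: dg; case: g g1 {g2} => /= ? ? -> ->.
(* B collects the g1 for which (g1, 0) has a radical of order Q^6. *)
exfalso; pose B := [set b : K | (b != 0) && (d (b, 0%R) == 3%N)].
have T0 : T (0, 0) = a.
  apply: (mulfI a0); apply: (@intr_inj algC).
  by rewrite -hT hsum0 -expr2 a2 rmorph_nat.
have sumP : \sum_g P (T g) = P a - c * #|B|%:R.
  rewrite (bigD1 (0, 0)) //= T0; congr (_ + _).
  rewrite (eq_bigr (fun g : K * K => if (g.2 == 0) && (g.1 \in B) then - c else 0)).
    rewrite -big_mkcondr /=.
    rewrite (reindex_onto (fun b : K => (b, 0)) fst) /=; last first.
      by move=> [x y] /= /andP[_ /andP[/eqP -> _]].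
    rewrite (eq_bigl (mem B)).
      by rewrite sumr_const -[LHS]mulr_natr mulNr.
    by move=> b /=; rewrite !xpair_eqE !eqxx !inE !andbT; case: eqP.
  move=> [x y] g0 /=; rewrite PT //; have := none (x, y); rewrite /= inE.
  move: g0; rewrite xpair_eqE; case: (eqVneq y 0) => [->|y0] /= H.
    by rewrite andbT in H; rewrite H.
  by move=> ->.
have M (k : nat) (I : nat) : \sum_g hsum g ^+ k = (#|K| ^ 2 * I)%:R ->
    a ^+ k * \sum_g T g ^+ k = a ^+ 4 * I%:R.
  move=> H; apply: (@intr_inj algC); rewrite mulr_sumr rmorph_sum.
  rewrite (eq_bigr (fun g => hsum g ^+ k)).
    rewrite H; have -> : a ^+ 4 = (#|K| ^ 2)%:R by rewrite natrX -a2 -exprM.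
    by rewrite -natrM rmorph_nat.
  by move=> g _; rewrite hT -rmorphXn /= exprMn.
have M1 : \sum_g T g = a ^+ 3.
  apply: (mulfI a0); transitivity (a ^+ 1 * \sum_g T g ^+ 1).
    by rewrite expr1; congr (_ * _); apply: eq_bigr => g _; rewrite expr1.
  rewrite (@M 1%N 1%N) ?mulr1 -?exprS // muln1 -moment1.
  by apply: eq_bigr => g _; rewrite expr1.
have M2 : \sum_g T g ^+ 2 = a ^+ 2 * (1 + (a ^+ 2 - 1) * (Q%:R + 1)).
  apply: (mulfI (expf_neq0 2 a0)); rewrite (M _ _ moment2) mulrA -exprD.
  by rewrite natrD natrM q1 -[Q.+1%:R]natr1.
have M3 : \sum_g T g ^+ 3 =
    a * (1 + (a ^+ 2 - 1) * (Q%:R + 1) + (a ^+ 2 - 1) * #|herm_affine|%:R).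
  apply: (mulfI (expf_neq0 3 a0)); rewrite (M _ _ moment3) mulrA -exprSr.
  by rewrite !natrD !natrM q1 -[Q.+1%:R]natr1.
have M0 : \sum_(g : K * K) (1 : int) = a ^+ 4.
  by rewrite sumr_const card_prod natrM -a2 -exprD.
have T2 : #|B|%:R * Q%:R ^+ 6 + a ^+ 2 <= 1 + (a ^+ 2 - 1) * (Q%:R ^+ 3 + 1) :> int.
  have a2_gt0 : 0 < a ^+ 2 by rewrite exprn_even_gt0.
  rewrite -(ler_pM2l a2_gt0).
  apply: (@le_trans _ _ (a ^+ 2 * \sum_b T (b, 0) ^+ 2)).
    rewrite ler_pM2l // (bigD1 0) //= T0 [leLHS]addrC lerD2l.
    rewrite -sum1_card natr_sum mulr_suml [X in X <= _]big_mkcond [X in _ <= X]big_mkcond /=.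
    apply: ler_sum => b _; rewrite inE; case: eqP => //= b0; case: eqP => [db|_].
      by rewrite mul1r /T db -exprM -[in X in _ <= X]mulN1r exprMn -signr_odd mul1r.
    by rewrite sqr_ge0.
  rewrite -(ler_int algC) mulr_sumr rmorph_sum /=.
  rewrite (eq_bigr (fun b => hsum (b, 0) ^+ 2)) => [|b _].
    apply: le_trans line_moment2 _; rewrite le_eqVlt; apply/orP; left; apply/eqP.
    rewrite -[LHS](rmorph_nat intr); congr _%:~R.
    by rewrite natrM natrD natrM q1 a2 natrD natrX.
  by rewrite hT -rmorphXn /= exprMn.
apply: (@moment_contradiction Q%:R a #|herm_affine|%:R #|B|%:R) => //.
- by rewrite ler_nat.
- rewrite /a normrX normrN normr_nat ler_eXn2l //.
  by rewrite ltr1n.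
- by rewrite -!natrX -natrD ler_nat card_herm_affine_le.
rewrite -M3 -M2 -M1 -M0 -[RHS]sumP.
rewrite !mulr_sumr -!sumrB -big_split /=; apply: eq_bigr => g _.
by rewrite /P; ring.
Qed.
End Family.

From mathcomp Require Import boolp classical_sets functions cardinality.

(** * Rational functions integral over a polynomial ring *)

Lemma fractionP (R : idomainType) (a : {fraction R}) :
  exists u v : R, v != 0 /\ a = tofrac u / tofrac v.
Proof.
elim/quotW: a => r; exists (frac r).1, (frac r).2; split; first exact: denom_ratioP.
have d0 := denom_ratioP r.
rewrite /=; unlock FracField.tofrac.
rewrite -[X in _ = _ * X]FracField.pi_inv -[RHS]FracField.pi_mul.
rewrite /FracField.mulf /FracField.invf.
by rewrite !numden_Ratio ?oner_neq0 // mulr1 mul1r Ratio_numden.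
Qed.

Section Closed.
Variables (K F : fieldType) (A : {rmorphism {poly K} -> F}).
Hypothesis A_inj : injective A.
Hypothesis A_frac : forall a, exists u v, v != 0 /\ a = A u / A v.

(** The rational root theorem.  Stated for a ring A that may be K[x] as well as
K[1/x], both sitting inside K(x). *)
Lemma poly_int_closed a : integralOver A a -> exists u, a = A u.
Proof.
have A0 (v : {poly K}) : v != 0 -> A v != 0 by rewrite -(rmorph0 A) (inj_eq A_inj).
have [u0 [v0 [v00 aE0]]] := A_frac a.
have [u [v [cuv v_neq0 aE]]] : exists u v, [/\ coprimep u v, v != 0 & a = A u / A v].
  pose g := gcdp u0 v0; have g0 : g != 0 by rewrite gcdp_eq0 negb_and v00 orbT.
  exists (u0 %/ g), (v0 %/ g); split.
  - by rewrite coprimep_div_gcd // v00 orbT.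
  - by apply: contraNneq v00 => E; rewrite -(divpK (dvdp_gcdr u0 v0)) -/g E mul0r.
  - have Eu : A u0 = A (u0 %/ g) * A g by rewrite -rmorphM divpK // dvdp_gcdl.
    have Ev : A v0 = A (v0 %/ g) * A g by rewrite -rmorphM divpK // dvdp_gcdr.
    by rewrite aE0 Eu Ev -mulf_div divff ?mulr1 // A0.
case=> q qm; rewrite rootE => /eqP q0.
have v1 : v %| u ^+ (size q).-1.
  have szq : size q = (size q).-1.+1 by rewrite prednK // size_poly_gt0 monic_neq0.
  have : A (\sum_(i < size q) q`_i * (u ^+ i * v ^+ ((size q).-1 - i))) = 0.
    transitivity (A v ^+ (size q).-1 * (map_poly A q).[a]); last by rewrite q0 mulr0.
    rewrite horner_poly mulr_sumr rmorph_sum; apply: eq_bigr => i _.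
    rewrite !rmorphM !rmorphXn [RHS]mulrCA; congr (_ * _).
    rewrite aE expr_div_n [RHS]mulrCA; congr (_ * _).
    have iq : (i <= (size q).-1)%N by rewrite -ltnS -szq.
    by rewrite -[in RHS](subnK iq) exprD mulfK // expf_neq0 // A0.
  rewrite -(rmorph0 A) => /A_inj; rewrite szq big_ord_recr /= subnn mulr1.
  have -> : q`_(size q).-1 = 1 by apply/eqP.
  rewrite mul1r => /eqP; rewrite addrC addr_eq0 => /eqP ->.
  rewrite dvdpNr; apply: (big_ind (fun w => v %| w)) => [|x y|i _]; [exact: dvdp0|exact: dvdp_add|].
  by rewrite !dvdp_mull // dvdp_exp // subn_gt0.
have v2 : size v = 1%N.
  apply/eqP; rewrite -coprimepp; apply: (coprimep_dvdl v1).
  by apply: coprimep_expr; rewrite coprimep_sym.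
have [c c0 vE] := size_poly1P v (introT eqP v2).
exists (c^-1 *: u); rewrite aE vE -mul_polyC rmorphM mulrC; congr (_ * _).
apply: (mulfI (A0 c%:P _)); first by rewrite polyC_eq0.
by rewrite mulfV ?A0 ?polyC_eq0 // -rmorphM -polyCM divff // rmorph1.
Qed.

End Closed.

(** * The function field of y^p - y = f(x) *)

Section Shift.
Variable R : comNzRingType.

Lemma coef_comp_X1 (P : {poly R}) n j : (size P <= n)%N ->
  (P \Po ('X + 1))`_j = \sum_(i < n) P`_i *+ 'C(i, j).
Proof.
move=> sz; rewrite comp_polyE.
rewrite (big_ord_widen n (fun i => P`_i *: ('X + 1) ^+ i)) //= coef_sum big_mkcond /=.
apply: eq_bigr => i _; case: ifP => iP; last by rewrite nth_default ?mul0rn // leqNgt iP.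
rewrite coefZ addrC exprDn coef_sum -mulr_natr; congr (_ * _).
have H (k : 'I_i.+1) : (1 ^+ (i - k) * 'X^k *+ 'C(i, k) : {poly R})`_j
   = if (k == j :> nat) then 'C(i, j)%:R else 0.
  rewrite expr1n mul1r coefMn coefXn eq_sym; case: eqP => [->|_] //.
  by rewrite mul0rn.
rewrite (eq_bigr (fun k : 'I_i.+1 => if (k == j :> nat) then 'C(i, j)%:R else 0));
  last by move=> k _; rewrite -H.
rewrite -big_mkcond /=; case: (ltnP j i.+1) => ji.
  by rewrite (big_pred1 (Ordinal ji)).
rewrite bin_small // big1 // => k _.
Qed.

(** The difference operator P(X+1) - P(X) lowers the degree, and by the next lemma
it multiplies the leading coefficient by the degree. *)
Lemma size_shift_sub (P : {poly R}) k : (size P <= k.+1)%N ->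
  (size (P \Po ('X + 1) - P)%R <= k)%N.
Proof.
move=> sz; apply/leq_sizeP => j kj.
rewrite coefB (coef_comp_X1 _ sz) big_ord_recr /= big1 ?add0r => [|i _]; last first.
  by rewrite bin_small // (leq_trans (ltn_ord i)).
have [->|jk] := eqVneq j k; first by rewrite binn mulr1n subrr.
have kj' : (k < j)%N by rewrite ltn_neqAle eq_sym jk.
by rewrite bin_small // sub0r nth_default ?oppr0 // (leq_trans sz).
Qed.

Lemma coef_shift_sub (P : {poly R}) k : (size P <= k.+2)%N ->
  (P \Po ('X + 1) - P)`_k = P`_k.+1 *+ k.+1.
Proof.
move=> sz; rewrite coefB (coef_comp_X1 _ sz) !big_ord_recr /= big1 ?add0r => [|i _]; last first.
  by rewrite bin_small.
by rewrite binn binSn mulr1n addrAC subrr add0r.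
Qed.
End Shift.

Lemma mulr_rot (R : comNzRingType) (a b c e : R) : a * b * c * e = c * (a * (b * e)).
Proof. by ring. Qed.

Lemma integral_exp (R S : comNzRingType) (h : {rmorphism R -> S}) u k :
  integralOver h u -> integralOver h (u ^+ k).
Proof.
move=> hu; elim: k => [|k IH]; first by rewrite expr0; exact: integral1.
by rewrite exprS; apply: integral_mul.
Qed.

Lemma integral_expP (R S : comNzRingType) (h : {rmorphism R -> S}) u k :
  (0 < k)%N -> integralOver h (u ^+ k) -> integralOver h u.
Proof.
move=> k0 hu; apply: (@integral_root_monic _ _ _ _ ('X^k - (u ^+ k)%:P)).
- exact: monicXnsubC.
- by apply/rootP; rewrite !hornerE subrr.
apply: (integral_poly _ _).1 => i; rewrite coefB coefXn coefC; apply: integral_sub.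
  by case: eqP => _; [exact: integral1|exact: integral0].
by case: eqP => _ //; exact: integral0.
Qed.

Lemma integral_sum (R S : comNzRingType) (h : {rmorphism R -> S}) I (r : seq I)
    (D : pred I) (G : I -> S) :
  (forall i, D i -> integralOver h (G i)) -> integralOver h (\sum_(i <- r | D i) G i).
Proof.
move=> H; apply: (big_ind (fun w => integralOver h w)) => //; first exact: integral0.
exact: integral_add.
Qed.

Lemma left_inverse_exp (R : comNzRingType) (u v : R) k n :
  v * u = 1 -> (k <= n)%N -> u ^+ n * v ^+ k = u ^+ (n - k).
Proof.
by move=> vu kn; rewrite -{1}(subnK kn) exprD -mulrA -exprMn [u * v]mulrC vu expr1n mulr1.
Qed.

Section FunctionField.
Variables (K : finFieldType) (p : nat) (f : {poly K}).
Hypotheses (p_prime : prime p) (pK : p \in [pchar K]).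
Let d := (size f).-1.
Hypothesis pd : coprime p d.

Let p_gt1 := prime_gt1 p_prime.
Let p_gt0 := prime_gt0 p_prime.

Lemma d_gt0 : (0 < d)%N.
Proof. by move: pd; case: d => //; rewrite /coprime gcdn0 => /eqP E; move: p_gt1; rewrite E. Qed.

Lemma f_neq0 : f != 0.
Proof. by rewrite -size_poly_gt0; have := d_gt0; rewrite /d; case: (size f). Qed.

Notation F := {fraction {poly K}}.
Notation tf := (@FracField.tofrac {poly K}).
Notation L := (AS_field p f).
Notation phi := (AS_embed p f).

(** The class in L of a polynomial in y with coefficients in K(x). *)
Definition clF (P : {poly F}) : L := in_qpoly (AS_poly p f) P.
Fact clF_zmod : zmod_morphism clF.
Proof. exact: (raddfB (in_qpoly (AS_poly p f))). Qed.
Fact clF_monoid : monoid_morphism clF.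
Proof. exact: in_qpoly_monoid_morphism. Qed.
HB.instance Definition _ := GRing.isZmodMorphism.Build {poly F} L clF clF_zmod.
HB.instance Definition _ := GRing.isMonoidMorphism.Build {poly F} L clF clF_monoid.

Lemma clFB : {morph clF : P P' / P - P'}. Proof. exact: rmorphB. Qed.
Lemma clFM : {morph clF : P P' / P * P'}. Proof. exact: rmorphM. Qed.

Lemma size_AS : size (AS_poly p f) = p.+1.
Proof.
rewrite /AS_poly -addrA size_polyDl size_polyXn // ltnS -opprD size_polyN.
by rewrite size_XaddC.
Qed.

Lemma monic_AS : AS_poly p f \is monic.
Proof.
rewrite monicE /AS_poly -addrA lead_coefDl ?lead_coefXn //.
by rewrite size_polyXn ltnS -opprD size_polyN size_XaddC.
Qed.

Lemma clF_small (P : {poly F}) : (size P <= p)%N -> polyn (clF P) = P.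
Proof. by move=> sz; apply: in_qpoly_small; rewrite mk_monic_AS_poly // size_AS. Qed.

Lemma clF_surj (z : L) : exists2 P : {poly F}, (size P <= p)%N & z = clF P.
Proof.
have E : size (mk_monic (AS_poly p f)) = p.+1 by rewrite mk_monic_AS_poly // size_AS.
have szz : (size (polyn z) < p.+1)%N := leq_trans (size_mk_monic z) (eq_leq E).
by exists (polyn z) => //; apply: val_inj; rewrite /= -[LHS](clF_small szz).
Qed.

Lemma clF_inj (P : {poly F}) : (size P <= p)%N -> clF P = 0 -> P = 0.
Proof. by move=> sz E; rewrite -(clF_small sz) E. Qed.

Lemma clF_AS : clF (AS_poly p f) = 0.
Proof.
apply: val_inj => /=; rewrite mk_monic_AS_poly //.
exact: Pdiv.RingMonic.rmodpp monic_AS.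
Qed.

Lemma clF_eq0 P : clF P = 0 -> exists Q, P = Q * AS_poly p f.
Proof.
move=> E; exists (Pdiv.Ring.rdivp P (AS_poly p f)).
rewrite {1}(Pdiv.RingMonic.rdivp_eq monic_AS P).
have : polyn (clF P) = 0 by rewrite E.
by rewrite /= mk_monic_AS_poly // => ->; rewrite addr0.
Qed.

Lemma phiE a : phi a = clF a%:P.
Proof.
apply: val_inj; rewrite /= -[RHS]/(polyn (clF a%:P)) clF_small //.
by rewrite (leq_trans (size_polyC_leq1 _)) // ltnW.
Qed.

(* From here on the quotient ring enters through the lemmas above only. *)
Local Opaque AS_field AS_embed clF.

Lemma phi_inj : injective phi. Proof. exact: fmorph_inj. Qed.

Lemma pF : p \in [pchar F].
Proof.
have : p \in [pchar {poly K}] by rewrite pchar_poly.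
by move/(rmorph_pchar tf).
Qed.

Lemma AS_shift : AS_poly p f \Po ('X + 1) = AS_poly p f.
Proof.
rewrite /AS_poly !comp_polyB comp_Xn_poly comp_polyX comp_polyC.
have -> : ('X + 1) ^+ p = 'X^p + 1 :> {poly F}.
  have pP : p \in [pchar {poly F}] by rewrite pchar_poly pF.
  by rewrite exprDn_pchar ?expr1n // pnatE.
ring.
Qed.

Section Integral.
Variable A : {rmorphism {poly K} -> F}.
Notation intL := (integralOver (phi \o A)).

Lemma intL_const a : intL (phi a) <-> integralOver A a.
Proof.
split=> [[g gm /rootP g0]|]; last exact: integral_rmorph.
exists g => //; apply/rootP; apply: phi_inj.
by rewrite rmorph0 -g0 -horner_map /= map_poly_comp.
Qed.

(** The substitution y -> y + 1 respects the equation y^p - y = f. *)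
Lemma intL_shift P : intL (clF P) -> intL (clF (P \Po ('X + 1))).
Proof.
case=> g gm /rootP g0; exists g => //; apply/rootP.
have E (Q : {poly F}) : (map_poly (phi \o A) g).[clF Q] = clF ((map_poly (polyC \o A) g).[Q]).
  rewrite -horner_map /= -map_poly_comp; congr (_.[_]).
  by apply: eq_map_poly => c /=; rewrite phiE.
move: g0; rewrite !E => /clF_eq0[Q QE].
have -> : (map_poly (polyC \o A) g).[P \Po ('X + 1)] = (Q \Po ('X + 1)) * AS_poly p f.
  rewrite -[in RHS]AS_shift -comp_polyM -QE.
  rewrite !horner_coef (rmorph_sum (comp_poly ('X + 1))) /=; apply: eq_bigr => i _.
  by rewrite comp_polyM coef_map /= comp_polyC rmorphXn.
by rewrite rmorphM /= clF_AS mulr0.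
Qed.

(** The difference operator in y preserves integrality and lowers the degree, so k
of them leave the constant k! P_k; and k! is invertible because k < p. *)
Lemma int_lead k (P : {poly F}) : (k < p)%N -> (size P <= k.+1)%N ->
  intL (clF P) -> integralOver A P`_k.
Proof.
elim: k P => [|k IH] P kp sz intP.
  by apply: (proj1 (intL_const _)); rewrite phiE -(size1_polyC sz).
have := IH _ (ltnW kp) (size_shift_sub sz).
rewrite coef_shift_sub // => H.
have {H} : integralOver A (P`_k.+1 *+ k.+1).
  by apply: H; rewrite raddfB; apply: integral_sub => //; apply: intL_shift.
move=> H; have k0 : k.+1%:R != 0 :> K by rewrite -(dvdn_pcharf pK) gtnNdvd.
pose c : {poly K} := (k.+1%:R^-1)%:P.
have c1 : c *+ k.+1 = 1 by rewrite /c -polyCMn -[_ *+ _]mulr_natr mulVf.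
have := integral_mul (integral_id A c) H.
by rewrite mulrnAr -mulrnAl -rmorphMn c1 rmorph1 mul1r.
Qed.

(** The product tau y is a root of Y^p - tau^(p-1) Y - tau^p f. *)
Lemma clF_X_int (tau : {poly K}) :
  (exists g, A tau ^+ p * tofrac f = A g) -> intL (phi (A tau) * clF 'X).
Proof.
case=> g0 e0; pose g1 := tau ^+ p.-1.
have e1 : A tau ^+ p = A tau * A g1 by rewrite rmorphXn -exprS prednK.
have yp : clF 'X ^+ p = clF 'X + phi (tofrac f).
  rewrite phiE -rmorphXn -rmorphD /=; apply/eqP; rewrite -subr_eq0 -rmorphB /=.
  by rewrite opprD addrA clF_AS.
set u := _ * _; pose h : {poly {poly K}} := 'X^p - g1 *: 'X - g0%:P.
exists h.
  rewrite monicE /h -addrA lead_coefDl ?lead_coefXn // size_polyXn ltnS -opprD size_polyN.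
  apply: leq_trans (size_polyD _ _) _; rewrite geq_max.
  rewrite (leq_trans (size_scale_leq _ _)) ?size_polyX //=.
  by rewrite (leq_trans (size_polyC_leq1 _)) // ltnW.
apply/rootP; rewrite /h !rmorphB /= map_polyXn map_polyZ map_polyX map_polyC /=.
rewrite !hornerE /u exprMn yp -rmorphXn e1 /= -e0 e1 !rmorphM /=; ring.
Qed.

(** The leading coefficient c is integral by [int_lead], and c y^k becomes integral
after multiplication by tau^k; subtract it and descend.  The exponent k^2 is a
convenient bound for the accumulated powers of tau. *)
Lemma coef_int (tau : {poly K}) k (P : {poly F}) : intL (phi (A tau) * clF 'X) ->
  (k <= p)%N -> (size P <= k)%N -> intL (clF P) ->
  forall i, integralOver A (A (tau ^+ (k * k)) * P`_i).
Proof.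
move=> y_int; elim: k P => [|k IH] P kp sz intP i.
  by rewrite nth_default ?mulr0 ?(leq_trans sz) //; exact: integral0.
have c_int := int_lead kp sz intP; set c := P`_k in c_int.
pose P1 := A (tau ^+ k) *: (P - c *: 'X^k).
have P1E j : P1`_j = if (j < k)%N then A (tau ^+ k) * P`_j else 0.
  rewrite coefZ coefB coefZ coefXn; case: (ltngtP j k) => jk.
  - by rewrite mulr0 subr0.
  - by rewrite mulr0 subr0 nth_default ?mulr0 // (leq_trans sz).
  - by rewrite jk mulr1 subrr mulr0.
have szP1 : (size P1 <= k)%N.
  by apply/leq_sizeP => j kj; rewrite P1E ltnNge kj.
have intP1 : intL (clF P1).
  have -> : clF P1 = phi (A (tau ^+ k)) * clF P - phi c * (phi (A tau) * clF 'X) ^+ k.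
    rewrite /P1 -mul_polyC -mul_polyC rmorphM rmorphB rmorphM !rmorphXn /= !phiE.
    rewrite exprMn; ring.
  apply: integral_sub; apply: integral_mul => //.
  - exact: (integral_id (phi \o A)).
  - exact: (proj2 (intL_const c)).
  elim: (k) => [|j IHj]; first by rewrite expr0; exact: integral1.
  by rewrite exprS; apply: integral_mul.
have := IH _ (ltnW kp) szP1 intP1 i; rewrite P1E.
have -> : (k.+1 * k.+1 = k * k + k + k.+1)%N by lia.
case: (ltngtP i k) => ik H.
- rewrite !exprD !(rmorphM A) mulr_rot.
  exact: (integral_mul (integral_id A (tau ^+ k.+1)) H).
- have -> : P`_i = 0 by apply: nth_default; exact: leq_trans sz ik.
  by rewrite mulr0; exact: (integral0 A).
by rewrite ik; exact: (integral_mul (integral_id A _) c_int).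
Qed.
End Integral.

(** Evaluation of polynomials at an element of K(x); the image is K[x] or K[1/x]
when t is x or 1/x. *)
Definition ev (t : F) : {poly K} -> F :=
  horner_eval t \o map_poly (tf \o polyC).
HB.instance Definition _ t := GRing.RMorphism.on (ev t).

Lemma evM t : {morph ev t : q1 q2 / q1 * q2}. Proof. exact: rmorphM. Qed.
Lemma evXn t n : {morph ev t : q / q ^+ n}. Proof. exact: rmorphXn. Qed.

Lemma evE t q : ev t q = (map_poly (tf \o polyC) q).[t]. Proof. by []. Qed.

Lemma evX q : ev (tofrac 'X) q = tofrac q.
Proof.
rewrite evE map_poly_comp horner_map /=; congr tofrac.
by rewrite -[RHS]comp_polyXr.
Qed.

Lemma evC t c : ev t c%:P = tofrac c%:P.
Proof. by rewrite evE map_polyC hornerC. Qed.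

Lemma ev_polyX t : ev t 'X = t.
Proof. by rewrite evE map_polyX hornerX. Qed.

Lemma constK_ev t q : (map_poly (constK phi) q).[phi t] = phi (ev t q).
Proof. by rewrite evE -horner_map -map_poly_comp. Qed.

Lemma int_ext (R S : nzRingType) (f1 f2 : R -> S) z : f1 =1 f2 ->
  integralOver f1 z -> integralOver f2 z.
Proof. by move=> E [g gm g0]; exists g => //; rewrite -(eq_map_poly E). Qed.

Lemma O0_int z : O0 phi z <-> integralOver (phi \o ev (tofrac 'X)) z.
Proof. by split; apply: int_ext => q /=; rewrite -constK_ev. Qed.

Notation T := (tofrac 'X)^-1.

Lemma O1_int z : O1 phi z <-> integralOver (phi \o ev T) z.
Proof. by split; apply: int_ext => q /=; rewrite -constK_ev. Qed.

(** Reversing coefficients turns a polynomial in 1/x into one in x. *)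
Definition revN N (q : {poly K}) := \poly_(i < N.+1) q`_(N - i).

Lemma size_revN N q : (size (revN N q) <= N.+1)%N. Proof. exact: size_poly. Qed.

Lemma revNK N (q : {poly K}) : (size q <= N.+1)%N -> revN N (revN N q) = q.
Proof.
move=> sz; apply/polyP => i; rewrite !coef_poly; case: ltnP => iN.
  by rewrite ltnS leq_subr subKn.
by rewrite nth_default // (leq_trans sz).
Qed.

Lemma Xf_neq0 : tofrac 'X != 0 :> F. Proof. by rewrite tofrac_eq0 polyX_eq0. Qed.

Lemma evT_rev N (q : {poly K}) : (size q <= N.+1)%N ->
  (tofrac 'X) ^+ N * ev T q = tofrac (revN N q).
Proof.
move=> sz; rewrite evE (horner_coef_wide _ (n := N.+1)); last first.
  by rewrite (leq_trans (size_poly _ _)).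
rewrite mulr_sumr /revN poly_def rmorph_sum (reindex_inj rev_ord_inj) /=.
apply: eq_bigr => i _; rewrite coef_map /= subSS -mul_polyC rmorphM mulrCA; congr (_ * _).
have iN : (i <= N)%N by rewrite -ltnS.
rewrite rmorphXn /= exprVn -{1}(subnKC iN) exprD mulfK // expf_neq0 // Xf_neq0 //.
Qed.

Lemma evT_inj : injective (ev T).
Proof.
move=> q1 q2 E; apply/eqP; rewrite -subr_eq0; apply/eqP; set q := _ - _.
have q0 : ev T q = 0 by rewrite /q rmorphB /=; apply/eqP; rewrite subr_eq0; apply/eqP.
have := evT_rev (leqnSn (size q)); rewrite q0 mulr0 => /esym/eqP.
rewrite tofrac_eq0 => /eqP E0; rewrite -(revNK (leqnSn (size q))) E0.
by apply/polyP => i; rewrite coef_poly !coef0 if_same.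
Qed.

Lemma ev_inj_X : injective (ev (tofrac 'X)).
Proof. by move=> a b; rewrite !evX => /eqP; rewrite tofrac_eq => /eqP. Qed.

Lemma evX_frac (a : F) : exists u v, v != 0 /\ a = ev (tofrac 'X) u / ev (tofrac 'X) v.
Proof. by have [u [v H]] := fractionP a; exists u, v; rewrite !evX. Qed.

Lemma evT_frac (a : F) : exists u v, v != 0 /\ a = ev T u / ev T v.
Proof.
have [u [v [v0 ->]]] := fractionP a.
pose N := maxn (size u) (size v).
have su : (size u <= N.+1)%N by rewrite leqW // leq_maxl.
have sv : (size v <= N.+1)%N by rewrite leqW // leq_maxr.
exists (revN N u), (revN N v); split.
  by apply: contraNneq v0 => E; rewrite -(revNK sv) E;
    apply/eqP/polyP => i; rewrite coef_poly !coef0 if_same.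
have E (w : {poly K}) : (size w <= N.+1)%N -> tofrac w = (tofrac 'X) ^+ N * ev T (revN N w).
  by move=> sw; rewrite evT_rev ?size_revN // revNK.
by rewrite (E u) // (E v) // -mulf_div divff ?mul1r // expf_neq0 // Xf_neq0.
Qed.

(** * The affine coordinate ring *)

(** The class in L of a polynomial in x and y; the outer variable is y. *)
Definition cl : {poly {poly K}} -> L := clF \o map_poly tf.
HB.instance Definition _ := GRing.RMorphism.on cl.

Notation y := (cl 'X).
Notation x := (xcoord phi).

Lemma clE P : cl P = clF (map_poly tf P). Proof. by []. Qed.

Lemma cl0 : cl 0 = 0. Proof. exact: rmorph0. Qed.
Lemma cl1 : cl 1 = 1. Proof. exact: rmorph1. Qed.
Lemma clD : {morph cl : P P' / P + P'}. Proof. exact: rmorphD. Qed.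
Lemma clB : {morph cl : P P' / P - P'}. Proof. exact: rmorphB. Qed.
Lemma clN : {morph cl : P / - P}. Proof. exact: rmorphN. Qed.
Lemma clM : {morph cl : P P' / P * P'}. Proof. exact: rmorphM. Qed.
Lemma clXn n : {morph cl : P / P ^+ n}. Proof. exact: rmorphXn. Qed.
Lemma cl_sum I r (D : pred I) (G : I -> {poly {poly K}}) :
  cl (\sum_(i <- r | D i) G i) = \sum_(i <- r | D i) cl (G i).
Proof. exact: rmorph_sum. Qed.

Lemma cl_inj (P : {poly {poly K}}) : (size P <= p)%N -> cl P = 0 -> P = 0.
Proof.
move=> sz E; have tf_inj : injective tf by move=> a b /eqP; rewrite tofrac_eq => /eqP.
apply: (map_inj_poly tf_inj (rmorph0 tf)); rewrite rmorph0.
by apply: clF_inj E; rewrite (leq_trans (size_poly _ _)).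
Qed.

Lemma clC q : cl q%:P = phi (tofrac q).
Proof. by rewrite clE map_polyC phiE. Qed.

Lemma xE : x = cl 'X%:P. Proof. by rewrite clC. Qed.

Lemma constKE c : constK phi c = cl c%:P%:P. Proof. by rewrite clC. Qed.

Lemma clX : y = clF 'X. Proof. by rewrite clE map_polyX. Qed.

Lemma yp : y ^+ p = y + cl f%:P.
Proof.
have E : (map_poly tf ('X^p - 'X - f%:P) : {poly F}) = AS_poly p f.
  by rewrite !rmorphB /= map_polyXn map_polyX map_polyC.
have E2 : cl ('X^p - 'X - f%:P) = y ^+ p - y - cl f%:P.
  by rewrite !clB clXn.
by apply/eqP; rewrite -subr_eq0 opprD addrA -E2 clE E clF_AS.
Qed.

Lemma y_int0 : integralOver (phi \o ev (tofrac 'X)) y.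
Proof.
have -> : y = phi (ev (tofrac 'X) 1) * clF 'X by rewrite !rmorph1 mul1r clX.
apply: clF_X_int; exists f.
by rewrite rmorph1 expr1n mul1r; exact/esym/evX.
Qed.

Lemma cl_O0 P : O0 phi (cl P).
Proof.
apply/O0_int; elim/poly_ind: P => [|P c IH].
  by rewrite cl0; exact: integral0.
rewrite clD clM; apply: integral_add.
  by apply: integral_mul => //; exact: y_int0.
by rewrite clC -[tofrac c]evX; exact: (integral_id (phi \o ev (tofrac 'X)) c).
Qed.

(** As y itself is integral over K[x], [coef_int] applies with tau = 1; this
reflects that the discriminant of y^p - y - f is a unit. *)
Lemma O0P z : O0 phi z <-> exists2 P : {poly {poly K}}, (size P <= p)%N & z = cl P.
Proof.
split=> [/O0_int|[P _ ->]]; last exact: cl_O0.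
have [P sz ->] := clF_surj z => intP.
have yint : integralOver (phi \o ev (tofrac 'X)) (phi (ev (tofrac 'X) 1) * clF 'X).
  by rewrite !rmorph1 mul1r -clX; exact: y_int0.
have H := coef_int yint (leqnn p) sz intP.
have C i : exists u, tofrac u == P`_i.
  have := H i; rewrite expr1n rmorph1 mul1r => /(poly_int_closed ev_inj_X evX_frac) [u ->].
  by exists u; apply/eqP; exact/esym/evX.
exists (\poly_(i < p) xchoose (C i)); first exact: size_poly.
rewrite clE; congr clF; apply/polyP => i; rewrite coef_map coef_poly /=.
case: ltnP => ip; first by rewrite (eqP (xchooseP (C i))).
by rewrite tofrac0 nth_default // (leq_trans sz).
Qed.

(** * Regularity at infinity *)

Notation t := (xinv phi).

Lemma tx : t * x = 1.
Proof. by rewrite /xinv /xcoord -rmorphM mulVf ?rmorph1 // Xf_neq0. Qed.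

Lemma tE : t = phi T. Proof. by []. Qed.

Lemma tX k : t ^+ k * x ^+ k = 1.
Proof. by rewrite -exprMn tx expr1n. Qed.

Lemma tXK k z : t ^+ k * (x ^+ k * z) = z.
Proof. by rewrite mulrA tX mul1r. Qed.

Lemma phi_Xn k : phi (tofrac 'X ^+ k) = x ^+ k.
Proof. exact: rmorphXn. Qed.

Lemma xX k : x ^+ k = cl ('X^k)%:P.
Proof. by rewrite xE -clXn -polyC_exp. Qed.

Local Opaque xcoord xinv constK cl.

(** z = x^-n P(x, y), with P reduced to degree less than p in y. *)
Definition rep (z : L) (n : nat) (P : {poly {poly K}}) :=
  (size P <= p)%N /\ x ^+ n * z = cl P.

Lemma rep_shift z n P k : rep z n P -> rep z (k + n) ('X^k *: P).
Proof.
case=> sz E; split; first exact: leq_trans (size_scale_leq _ _) _.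
by rewrite exprD -mulrA E -mul_polyC clM xX.
Qed.

Lemma td_y_int : integralOver (phi \o ev T) (t ^+ d * y).
Proof.
have -> : t ^+ d = phi (ev T 'X^d) by rewrite evXn ev_polyX rmorphXn.
rewrite clX; apply: clF_X_int.
have sf : (size f <= d.+1)%N by rewrite /d leqSpred.
exists ('X^(p * d - d) * revN d f).
have evd k : ev T 'X^k = T ^+ k by rewrite evXn ev_polyX.
transitivity ((T ^+ d) ^+ p * (tofrac 'X ^+ d * ev T (revN d f))).
  by rewrite evT_rev ?size_revN // revNK // -evd.
rewrite [RHS]evM evd mulrA; congr (_ * _); rewrite -exprM mulnC.
have dp : (d <= p * d)%N by rewrite leq_pmull.
rewrite -{1}(subnK dp) exprD -mulrA -exprMn mulVf ?expr1n ?mulr1 // Xf_neq0 //.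
Qed.

(** A crude bound; what matters is that beyond n it depends on the curve only, so
that it stops the growth under p-th powers in [O1_const_bound]. *)
Lemma O1_coef_bound z n P : O1 phi z -> rep z n P ->
  forall i, (size (P`_i)%R <= n + d * (p * p) + 1)%N.
Proof.
move=> /O1_int intz [sz E] i; set M := (d * (p * p))%N.
have [P' sz' zE] := clF_surj z; rewrite zE in intz.
have yint : integralOver (phi \o ev T) (phi (ev T 'X^d) * clF 'X).
  by rewrite evXn ev_polyX rmorphXn -clX; exact: td_y_int.
have := coef_int yint (leqnn p) sz' intz i.
case/(poly_int_closed evT_inj evT_frac) => g.
rewrite -exprM -/M => gE0.
have gE : T ^+ M * P'`_i = ev T g by rewrite -gE0 -[in LHS](ev_polyX T) -evXn.
have PE : tofrac P`_i = tofrac 'X ^+ n * P'`_i.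
  have : map_poly tf P = (tofrac 'X ^+ n)%:P * P'.
    apply/eqP; rewrite -subr_eq0; apply/eqP; apply: clF_inj.
      rewrite (leq_trans (size_polyD _ _)) // geq_max size_polyN mul_polyC.
      by rewrite (leq_trans (size_poly _ _)) // (leq_trans (size_scale_leq _ _)).
    by rewrite clFB clFM -clE -E zE -phiE rmorphXn subrr.
  by move/polyP/(_ i); rewrite coef_map coefCM.
pose N := size g.
have : tofrac ('X^N * P`_i) = tofrac ('X^(n + M) * revN N g) :> F.
  rewrite !rmorphM !rmorphXn /= PE -(evT_rev (leqnSn N)) -gE exprD.
  rewrite exprVn mulrCA -!mulrA; congr (_ * _).
  rewrite [X in _ = _ * X]mulrCA mulVKf // expf_neq0 // Xf_neq0 //.
move/eqP; rewrite tofrac_eq => /eqP H.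
have [->|P0] := eqVneq P`_i 0; first by rewrite size_poly0.
have : (size ('X^N * P`_i)%R <= (n + M) + N.+1)%N.
  rewrite H; have [->|r0] := eqVneq (revN N g) 0; first by rewrite mulr0 size_poly0.
  by rewrite size_monicM ?monicXn // size_polyXn /= leq_add2l size_revN.
by rewrite size_monicM ?monicXn // size_polyXn /=; lia.
Qed.

(** From y^p = y + f, the p-th power of \sum_i P_i y^i is \sum_i P_i^p (y + f)^i,
which is again reduced. *)
Definition frobP (P : {poly {poly K}}) : {poly {poly K}} :=
  \sum_(i < p) (P`_i ^+ p)%:P * ('X + f%:P) ^+ i.

Lemma rep_frob z n P : rep z n P -> rep (z ^+ p) (p * n) (frobP P).
Proof.
case=> sz E; split.
  rewrite /frobP; apply: leq_trans (size_sum _ _ _) _; apply/bigmax_leqP => i _.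
  rewrite mul_polyC; apply: leq_trans (size_scale_leq _ _) _.
  by rewrite -[f%:P]opprK -polyCN size_exp_XsubC.
have pL : p \in [pchar L] by apply: (rmorph_pchar phi); exact: pF.
have pKK : p \in [pchar {poly {poly K}}] by rewrite !pchar_poly.
rewrite mulnC exprM -exprMn E -clXn.
have -> : P ^+ p = \sum_(i < p) (P`_i ^+ p)%:P * ('X^p) ^+ i.
  rewrite -(pFrobenius_autE pKK) -{1}(coefK P) poly_def.
  rewrite (big_ord_widen p (fun i => P`_i *: 'X^i)) //.
  rewrite big_mkcond rmorph_sum; apply: eq_bigr => i _.
  case: ifP => iP.
    transitivity ((P`_i *: 'X^i) ^+ p); first by [].
    by rewrite -mul_polyC exprMn polyC_exp -!exprM mulnC.
  rewrite nth_default; last by rewrite leqNgt iP.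
  by rewrite raddf0 expr0n (gtn_eqF p_gt0) mul0r.
rewrite /frobP !cl_sum; apply: eq_bigr => i _.
by rewrite !clM !clXn yp clD.
Qed.

Lemma frobP0 P : (frobP P)`_0 = \sum_(i < p) P`_i ^+ p * f ^+ i.
Proof.
rewrite -horner_coef0 /frobP horner_sum; apply: eq_bigr => i _.
by rewrite !hornerE.
Qed.

(** The nonzero terms have the degrees p deg P_i + d i, which are distinct modulo p
for i < p; so the largest of them survives. *)
Lemma size_frob_sum (P : {poly {poly K}}) (j : 'I_p) : P`_j != 0 ->
  (p * (size (P`_j)%R).-1 + d * j < size (\sum_(i < p) P`_i ^+ p * f ^+ i)%R)%N.
Proof.
move=> Pj; pose w (i : 'I_p) := (p * (size (P`_i)%R).-1 + d * i)%N.
have [k Pk kmax] := @arg_maxnP _ j (fun i => P`_i != 0) w Pj.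
apply: (@leq_ltn_trans (w k)); first exact: kmax.
have szt (i : 'I_p) : P`_i != 0 -> size (P`_i ^+ p * f ^+ i)%R = (w i).+1.
  move=> Pi; have szX (q : {poly K}) m : q != 0 -> size (q ^+ m) = ((size q).-1 * m).+1.
    by move=> q0; rewrite -size_exp prednK // size_poly_gt0 expf_neq0.
  rewrite size_mul ?expf_neq0 ?f_neq0 // !szX ?f_neq0 //.
  by rewrite addSn addnS /= mulnC.
have winj (i i' : 'I_p) : w i = w i' -> i = i'.
  wlog ii : i i' / (i <= i')%N => [H E|E].
    by case/orP: (leq_total i i') => /H; [exact|move=> H'; exact/esym/H'].
  apply: val_inj => /=; apply/eqP; rewrite eqn_leq ii /= -subn_eq0.
  have : (p %| d * (i' - i))%N.
    rewrite mulnBr; have -> : (d * i' - d * i = p * (size (P`_i)%R).-1 - p * (size (P`_i')%R).-1)%N.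
      by move: E; rewrite /w; lia.
    by rewrite -mulnBr dvdn_mulr.
  by rewrite Gauss_dvdr // /dvdn modn_small // (leq_ltn_trans (leq_subr _ _)).
rewrite ltnNge; apply/negP => /leq_sizeP/(_ _ (leqnn _)); rewrite coef_sum (bigD1 k) //= big1.
  rewrite addr0; have := szt k Pk => E.
  have : lead_coef (P`_k ^+ p * f ^+ k) != 0 by rewrite lead_coef_eq0 -size_poly_gt0 E.
  by rewrite lead_coefE E /= => /eqP.
move=> i ik; have [->|Pi] := eqVneq P`_i 0; first by rewrite expr0n (gtn_eqF p_gt0) mul0r coef0.
rewrite nth_default // szt //.
have le_ik : (w i <= w k)%N := kmax i Pi.
by rewrite ltn_neqAle le_ik andbT; apply: contra ik => /eqP/winj ->.
Qed.

Lemma O1D z w : O1 phi z -> O1 phi w -> O1 phi (z + w).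
Proof. by move=> /O1_int hz /O1_int hw; apply/O1_int; exact: integral_add. Qed.
Lemma O1B z w : O1 phi z -> O1 phi w -> O1 phi (z - w).
Proof. by move=> /O1_int hz /O1_int hw; apply/O1_int; exact: integral_sub. Qed.
Lemma O1M z w : O1 phi z -> O1 phi w -> O1 phi (z * w).
Proof. by move=> /O1_int hz /O1_int hw; apply/O1_int; exact: integral_mul. Qed.
Lemma O1X z k : O1 phi z -> O1 phi (z ^+ k).
Proof. by move=> /O1_int hz; apply/O1_int; exact: integral_exp. Qed.
Lemma O1_root z k : (0 < k)%N -> O1 phi (z ^+ k) -> O1 phi z.
Proof. by move=> k0 /O1_int hz; apply/O1_int; exact: integral_expP hz. Qed.
Lemma O1_sum I (r : seq I) (D : pred I) (G : I -> L) :
  (forall i, D i -> O1 phi (G i)) -> O1 phi (\sum_(i <- r | D i) G i).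
Proof. by move=> H; apply/O1_int; apply: integral_sum => i /H/O1_int. Qed.
Lemma O1_ev q : O1 phi (phi (ev T q)).
Proof. apply/O1_int; exact: (integral_id (phi \o ev T) q). Qed.

Lemma O1_t k : O1 phi (t ^+ k).
Proof. by apply: O1X; rewrite tE -(ev_polyX T); exact: O1_ev. Qed.

Lemma O1_constK c : O1 phi (constK phi c).
Proof. by rewrite constKE clC -(evC T); exact: O1_ev. Qed.

Lemma O1_td_yp : O1 phi (t ^+ d * y ^+ p).
Proof.
rewrite yp mulrDr; apply: O1D; first by apply/O1_int; exact: td_y_int.
have sf : (size f <= d.+1)%N by rewrite /d leqSpred.
have fE : tofrac f = tofrac 'X ^+ d * ev T (revN d f) by rewrite evT_rev ?size_revN // revNK.
rewrite clC fE (rmorphM phi) phi_Xn tXK.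
exact: O1_ev.
Qed.

(** The p-th power is t^(p c - d j) (t^d y^p)^j, and t^d y^p = t^d y + t^d f is
integral over K[1/x]. *)
Lemma mono_O1 c j : (d * j <= p * c)%N -> O1 phi (t ^+ c * y ^+ j).
Proof.
move=> H; apply: (O1_root p_gt0).
have -> : (t ^+ c * y ^+ j) ^+ p = t ^+ (p * c - d * j) * (t ^+ d * y ^+ p) ^+ j.
  rewrite !exprMn -!exprM mulrA -exprD subnK // [(c * p)%N]mulnC [(j * p)%N]mulnC //.
by apply: O1M; [exact: O1_t|apply: O1X; exact: O1_td_yp].
Qed.

Lemma cl_expand (P : {poly {poly K}}) : (size P <= p)%N ->
  cl P = \sum_(i < p) cl (P`_i)%:P * y ^+ i.
Proof.
move=> sz; rewrite -{1}(coefK P) poly_def (big_ord_widen p (fun i => P`_i *: 'X^i)) //.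
rewrite big_mkcond cl_sum; apply: eq_bigr => i _; case: ifP => iP.
  by rewrite -mul_polyC clM clXn.
by rewrite nth_default ?cl0 ?mul0r // leqNgt iP.
Qed.

Lemma rep_expand z n P : rep z n P ->
  z = \sum_(i < p) \sum_(a < size (P`_i)%R) constK phi (P`_i)`_a * (t ^+ n * x ^+ a * y ^+ i).
Proof.
case=> sz E.
have -> : z = t ^+ n * cl P by rewrite -E tXK.
rewrite (cl_expand sz).
rewrite mulr_sumr.
apply: eq_bigr => i _.
have -> : (P`_i)%:P = \sum_(a < size (P`_i)%R) ((P`_i)`_a)%:P%:P * ('X^a)%:P.
  rewrite -{1}(coefK P`_i) poly_def raddf_sum; apply: eq_bigr => a _.
  by rewrite -polyCM mul_polyC.
rewrite cl_sum mulr_suml mulr_sumr; apply: eq_bigr => a _.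
by rewrite clM -constKE -xX -!mulrA mulrCA.
Qed.

(** The pole order of x^a y^i at infinity is p a + d i. *)
Definition regular_at_infinity n (P : {poly {poly K}}) :=
  forall j : 'I_p, P`_j != 0 -> (p * (size (P`_j)%R).-1 + d * j <= p * n)%N.

Lemma rep_O1 z n P : rep z n P -> regular_at_infinity n P -> O1 phi z.
Proof.
move=> R reg; rewrite (rep_expand R); apply: O1_sum => i _; apply: O1_sum => a _.
apply: O1M; first exact: O1_constK.
have Pi : P`_i != 0 by apply/eqP => E; case: a => a /=; rewrite E size_poly0.
have H := reg i Pi; have al : (a <= (size (P`_i)%R).-1)%N.
  by rewrite -ltnS prednK // size_poly_gt0.
have pa : (p * a <= p * (size (P`_i)%R).-1)%N by rewrite leq_pmul2l.
have an : (a <= n)%N by rewrite -(leq_pmul2l p_gt0); lia.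
rewrite -(subnK an) exprD -!mulrA tXK.
by apply: mono_O1; rewrite mulnBr; lia.
Qed.

Lemma O01P z : O01 phi z <-> exists n P, rep z n P.
Proof.
split=> [[n /O0P[P sz E]]|[n [P [_ E]]]]; first by exists n, P.
by exists n; rewrite E; exact: cl_O0.
Qed.

(** The poles of an element of O1 lie over x = 0, so multiplication by a power of x
removes them. *)
Lemma O1_rep z : O1 phi z -> exists n P, rep z n P.
Proof.
move=> /O1_int intz; set M := (d * (p * p))%N.
have [P' sz' zE] := clF_surj z; rewrite zE in intz.
have yint : integralOver (phi \o ev T) (phi (ev T 'X^d) * clF 'X).
  by rewrite evXn ev_polyX rmorphXn -clX; exact: td_y_int.
have H i : exists g, T ^+ M * P'`_i == ev T g.
  have [g gE] := poly_int_closed evT_inj evT_frac (coef_int yint (leqnn p) sz' intz i).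
  exists g; apply/eqP; rewrite -[RHS]gE -exprM -/M; congr (_ * _).
  by rewrite -[in LHS](ev_polyX T) -evXn.
pose g i := xchoose (H i); pose N := (\max_(i < p) size (g i))%N.
have gE i : T ^+ M * P'`_i = ev T (g i) by apply/eqP/(xchooseP (H i)).
have gN (i : 'I_p) : (size (g i) <= N.+1)%N.
  by rewrite leqW //; exact: (leq_bigmax (F := fun i : 'I_p => size (g i))).
exists N, (\poly_(i < p) ('X^M * revN N (g i))); split; first exact: size_poly.
rewrite zE -phi_Xn phiE -clFM clE; congr clF; apply/polyP => j.
rewrite coefCM coef_map coef_poly /=; case: ltnP => jp; last first.
  by rewrite tofrac0 (nth_default _ (leq_trans sz' jp)) mulr0.
rewrite tofracM -(evT_rev (gN (Ordinal jp))) -gE tofracXn exprVn mulrCA; congr (_ * _).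
by rewrite mulVKf // expf_neq0 // Xf_neq0.
Qed.

(** If deg P_0 exceeded n by k > 0, the constant coefficient of z^p would exceed
p n by p k > k.  So the bound of [O1_coef_bound] can be lowered step by step. *)
Lemma O1_const_bound z n P : O1 phi z -> rep z n P -> (size (P`_0)%R <= n + 1)%N.
Proof.
suff H k : (forall z n P, O1 phi z -> rep z n P -> (size (P`_0)%R <= n + k.+1)%N) ->
    forall z n P, O1 phi z -> rep z n P -> (size (P`_0)%R <= n + 1)%N.
  apply: (H (d * (p * p))%N) => z' n' P' O R.
  by have := O1_coef_bound O R 0; rewrite addn1 addnS.
elim: k => [|k IH] bnd //; apply: IH => {}z {}n {}P O R.
have := bnd _ _ _ (O1X p O) (rep_frob R); rewrite frobP0.
have [->|P0] := eqVneq P`_0 0; first by rewrite size_poly0.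
move=> le1; have := leq_trans (size_frob_sum (j := Ordinal p_gt0) P0) le1.
rewrite /= muln0 addn0; have : (0 < size (P`_0)%R)%N by rewrite size_poly_gt0.
move: p_gt1; case: (size _) => // s; rewrite /= => p1 _ le2; rewrite leqNgt; apply/negP => lt3.
have : (p * (n + k.+1) <= p * s)%N by rewrite leq_pmul2l //; lia.
have : (2 * k.+1 <= p * k.+1)%N by rewrite leq_pmul2r.
lia.
Qed.

Lemma O1_regular z n P : O1 phi z -> rep z n P -> regular_at_infinity n P.
Proof.
move=> O R j Pj; have := O1_const_bound (O1X p O) (rep_frob R).
rewrite frobP0 => H; have := leq_trans (size_frob_sum Pj) H.
by rewrite addn1 ltnS.
Qed.

Lemma constK0 : constK phi 0 = 0.
Proof. by rewrite constKE !polyC0 cl0. Qed.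

(** * Rational points *)

Definition evalXY (a b : K) (P : {poly {poly K}}) : K := (P.[b%:P]).[a].

Lemma evalXYB a b P P' : evalXY a b (P - P') = evalXY a b P - evalXY a b P'.
Proof. by rewrite /evalXY !hornerE. Qed.
Lemma evalXYD a b P P' : evalXY a b (P + P') = evalXY a b P + evalXY a b P'.
Proof. by rewrite /evalXY !hornerE. Qed.
Lemma evalXYM a b P P' : evalXY a b (P * P') = evalXY a b P * evalXY a b P'.
Proof. by rewrite /evalXY !hornerE. Qed.
Lemma evalXYC a b c : evalXY a b c%:P%:P = c.
Proof. by rewrite /evalXY !hornerE. Qed.

Definition ASxy : {poly {poly K}} := 'X^p - 'X - f%:P.

Lemma evalXY_AS a b : evalXY a b ASxy = b ^+ p - b - f.[a].
Proof. by rewrite /evalXY /ASxy !hornerE. Qed.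

Lemma cl_AS : cl ASxy = 0.
Proof. by rewrite /ASxy !clB clXn yp [y + _]addrC addrK subrr. Qed.

Lemma cl_eq0 P : cl P = 0 -> exists Q, P = Q * ASxy.
Proof.
have szl : (size (- 'X - f%:P : {poly {poly K}})%R < p.+1)%N.
  by rewrite -opprD size_polyN size_XaddC.
have mon : ASxy \is monic.
  by rewrite monicE /ASxy -addrA lead_coefDl ?lead_coefXn // size_polyXn.
have sz : size ASxy = p.+1 by rewrite /ASxy -addrA size_polyDl size_polyXn.
move=> P0; exists (Pdiv.Ring.rdivp P ASxy).
have E := Pdiv.RingMonic.rdivp_eq mon P; rewrite {1}E.
suff -> : Pdiv.Ring.rmodp P ASxy = 0 by rewrite addr0.
apply: cl_inj; first by rewrite -ltnS -sz Pdiv.Ring.ltn_rmodpN0 // monic_neq0.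
by move: P0; rewrite {1}E clD clM cl_AS mulr0 add0r.
Qed.

Definition on_curve (u : K * K) := u.2 ^+ p - u.2 == f.[u.1].

Lemma cl_evalXY a b P P' : on_curve (a, b) -> cl P = cl P' -> evalXY a b P = evalXY a b P'.
Proof.
move=> /eqP /= ab /eqP; rewrite -subr_eq0 -clB => /eqP/cl_eq0[Q QE].
by apply/eqP; rewrite -subr_eq0 -evalXYB QE evalXYM evalXY_AS ab subrr mulr0.
Qed.

Definition affine_point (u : K * K) : set L :=
  [set z | exists2 P, z = cl P & evalXY u.1 u.2 P = 0].

Lemma affine_point_rational u : on_curve u -> rational_point phi (O0 phi) (affine_point u).
Proof.
case: u => a b ab; split.
- by move=> _ [P -> _]; exact: cl_O0.
- by exists 0; rewrite ?cl0 // /evalXY !hornerE.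
- by move=> _ _ [P -> P0] [P' -> P'0]; exists (P + P'); rewrite ?clD // evalXYD P0 P'0 addr0.
- move=> z _ /O0P[Q _ ->] [P -> P0]; exists (Q * P); first by rewrite clM.
  by rewrite evalXYM P0 mulr0.
move=> z /O0P[Q _ ->]; exists (evalXY a b Q); split.
  exists (Q - (evalXY a b Q)%:P%:P); first by rewrite clB constKE.
  by rewrite evalXYB evalXYC subrr.
move=> c [P E P0]; have E2 : cl (Q - c%:P%:P) = cl P by rewrite clB -constKE.
have := cl_evalXY ab E2; rewrite evalXYB evalXYC P0 => /eqP.
by rewrite subr_eq0 => /eqP.
Qed.

(** A rational point is a proper ideal: the residue of a constant is unique. *)
Lemma rational_point_const A M c : rational_point phi A M -> A (constK phi c) ->
  M (constK phi c) -> c = 0.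
Proof.
case=> MA M0 _ _ H Ac Mc; have [c0 [_ U]] := H _ Ac.
have c0c : c0 = c by apply: U; rewrite subrr.
have c00 : c0 = 0 by apply: U; rewrite constK0 subr0.
by rewrite -c0c.
Qed.

(** The residues a of x and b of y determine M, as P(x, y) - P(a, b) is a
combination of y - b and x - a. *)
Lemma affine_pointP M : rational_point phi (O0 phi) M ->
  exists2 u, on_curve u & M = affine_point u.
Proof.
move=> rM; have [MA M0 MD MM H] := rM.
have cO c : O0 phi (constK phi c) by rewrite constKE; exact: cl_O0.
have [a [Ma _]] := H _ (cl_O0 'X%:P).
have [b [Mb _]] := H _ (cl_O0 'X).
have key P : M (cl P - constK phi (evalXY a b P)).
  have r1 : root (P - P.[b%:P]%:P) b%:P by rewrite rootE !hornerE subrr.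
  have [Q1 Q1E] := factor_theorem _ _ r1.
  have r2 : root (P.[b%:P] - P.[b%:P].[a]%:P) a by rewrite rootE !hornerE subrr.
  have [Q2 Q2E] := factor_theorem _ _ r2.
  have -> : cl P - constK phi (evalXY a b P) =
      cl Q1 * (cl 'X - constK phi b) + cl Q2%:P * (cl 'X%:P - constK phi a).
    rewrite !constKE -!clB -!clM -clD; congr cl.
    by rewrite -Q1E -polyCB -polyCM -Q2E polyCB addrA subrK.
  by apply: MD; apply: MM => //; exact: cl_O0.
have zero c : M (constK phi c) -> c = 0 := rational_point_const rM (cO c).
have MN z : M z -> M (- z).
  move=> Mz; have -> : - z = constK phi (-1) * z by rewrite constKE !polyCN clN !polyC1 cl1 mulN1r.
  exact: MM.
exists (a, b).
  have := MN _ (key ASxy); rewrite cl_AS evalXY_AS sub0r opprK => /zero/eqP.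
  by rewrite subr_eq0.
rewrite eqEsubset; split=> [z Mz|_ [P -> P0]].
  have /O0P[P _ zE] := MA _ Mz; exists P => //; apply: zero.
  have := MD _ _ Mz (MN _ (key P)); rewrite -zE opprB addrCA subrr addr0.
  exact.
by have := key P; rewrite P0 constK0 subr0.
Qed.

(** Since x has a pole of order p at infinity, the second condition says that z
vanishes there. *)
Definition point_at_infinity : set L := [set z | O1 phi z /\ O1 phi (x * z ^+ p)].

Lemma pL : p \in [pchar L].
Proof. by apply: (rmorph_pchar phi); exact: pF. Qed.

Lemma expDp (z w : L) : (z + w) ^+ p = z ^+ p + w ^+ p.
Proof. by rewrite exprDn_pchar // pnatE // pL. Qed.

Lemma x_notO1 : ~ O1 phi x.
Proof.
move=> O; have R : rep x 0 'X%:P.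
  split; last by rewrite expr0 mul1r xE.
  by rewrite (leq_trans (size_polyC_leq1 _)) // ltnW.
have := O1_regular O R (j := Ordinal p_gt0).
by rewrite coefC /= polyX_eq0 size_polyX => /(_ isT); move: p_gt0; lia.
Qed.

Lemma infinity_const c : point_at_infinity (constK phi c) -> c = 0.
Proof.
case=> _ O; apply/eqP; apply/negP => /negP c0; apply: x_notO1.
suff -> : x = constK phi (c^-1) ^+ p * (x * constK phi c ^+ p).
  exact: (O1M (O1X p (O1_constK _)) O).
rewrite mulrCA -exprMn constKE constKE -clM -!polyCM mulVf // !polyC1 cl1 expr1n mulr1 //.
Qed.

Lemma infinityD z w : point_at_infinity z -> point_at_infinity w -> point_at_infinity (z + w).
Proof. by case=> Oz Oz' [Ow Ow']; split; [exact: O1D|rewrite expDp mulrDr; exact: O1D]. Qed.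

Lemma infinityM z w : O1 phi z -> point_at_infinity w -> point_at_infinity (z * w).
Proof.
move=> Oz [Ow Ow']; split; first exact: O1M.
by rewrite exprMn mulrCA; apply: O1M => //; exact: O1X.
Qed.

Lemma infinity_sum I (r : seq I) (D : pred I) (G : I -> L) :
  (forall i, D i -> point_at_infinity (G i)) -> point_at_infinity (\sum_(i <- r | D i) G i).
Proof.
move=> H; apply: (big_ind point_at_infinity); [|exact: infinityD|exact: H].
have O0' : O1 phi 0 by rewrite -constK0; exact: O1_constK.
by split; rewrite // expr0n (gtn_eqF p_gt0) mulr0.
Qed.

Lemma mono_infinity c j : (d * j < p * c)%N -> point_at_infinity (t ^+ c * y ^+ j).
Proof.
move=> H; split; first by apply: mono_O1; exact: ltnW.
have -> : x * (t ^+ c * y ^+ j) ^+ p = t ^+ (p * c - d * j).-1 * (t ^+ d * y ^+ p) ^+ j.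
  rewrite !exprMn -!exprM mulrA [(j * p)%N]mulnC mulrA; congr (_ * _); rewrite -exprD.
  have -> : (c * p = ((p * c - d * j).-1 + d * j).+1)%N by rewrite mulnC; lia.
  by rewrite exprS mulrA [x * t]mulrC tx mul1r.
by apply: O1M; [exact: O1_t|apply: O1X; exact: O1_td_yp].
Qed.

Lemma exp_p (z : L) : z ^+ p = z * z ^+ p.-1.
Proof. by rewrite -exprS prednK. Qed.

Lemma infinity_xinv : point_at_infinity t.
Proof.
have O := O1_t; split; first by have := O 1%N; rewrite expr1.
have -> : x * t ^+ p = t ^+ p.-1; last exact: O.
by rewrite exp_p mulrA [x * t]mulrC tx mul1r.
Qed.

(** In z = x^-n P(x, y) only the monomial x^n can be nonzero at infinity. *)
Lemma infinity_residue z : O1 phi z -> exists c, point_at_infinity (z - constK phi c).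
Proof.
move=> O; have [n [P R]] := O1_rep O; have reg := O1_regular O R.
pose m i a : L := constK phi (P`_i)`_a * (t ^+ n * x ^+ a * y ^+ i).
have an (i : 'I_p) a : (a < size (P`_i)%R)%N -> (p * a + d * i <= p * n)%N.
  move=> al; have Pi : P`_i != 0 by apply: contraTneq al => ->; rewrite size_poly0.
  apply: leq_trans (reg i Pi); rewrite leq_add2r leq_pmul2l //.
  by rewrite -ltnS prednK // (leq_ltn_trans _ al).
have mE i a : (a <= n)%N -> m i a = constK phi (P`_i)`_a * (t ^+ (n - a) * y ^+ i).
  by move=> le; rewrite /m -{1}(subnK le) exprD -!mulrA tXK.
(* For 0 < i < p the inequality an is strict, as p does not divide d i. *)
have inf_m (i : 'I_p) a : (a < size (P`_i)%R)%N -> ~~ ((i == 0 :> nat) && (a == n)) ->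
    point_at_infinity (m i a).
  move=> al ia; have le := an i a al.
  have le' : (a <= n)%N by rewrite -(leq_pmul2l p_gt0); lia.
  rewrite mE //; apply: infinityM; first exact: O1_constK.
  apply: mono_infinity; rewrite mulnBr ltn_neqAle.
  have : (p * a <= p * n)%N by rewrite leq_pmul2l.
  move=> pan; apply/andP; split; last by lia.
  apply: contra ia => /eqP E.
  have pdi : (p %| d * i)%N by rewrite E -mulnBr dvdn_mulr.
  have i0 : (i : nat) = 0%N.
    move: pdi; rewrite Gauss_dvdr // => /dvdnP[[|c] cE]; first by rewrite cE.
    by have := ltn_ord i; rewrite cE mulSn ltnNge leq_addr.
  rewrite i0 eqxx /=; move: E; rewrite i0 muln0 => /esym/eqP.
  by rewrite subn_eq0 leq_pmul2l // => na; rewrite eqn_leq le' na.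
exists (P`_0)`_n; rewrite (rep_expand R) -/(m _ _).
rewrite (bigD1 (Ordinal p_gt0)) //= -[X in X + _ - _]/(\sum_(a < size (P`_0)%R) m 0%N a).
rewrite addrAC; apply: infinityD; last first.
  apply: infinity_sum => i i0; apply: infinity_sum => a _; apply: inf_m => //.
  by apply: contra i0 => /andP[i0 _]; apply/eqP/val_inj/eqP.
case: (ltnP n (size (P`_0)%R)) => nP; last first.
  rewrite [(P`_0)`_n]nth_default // constK0 subr0; apply: infinity_sum => a _.
  apply: (inf_m (Ordinal p_gt0)) => //=; rewrite neq_ltn (leq_trans _ nP) //.
rewrite (bigD1 (Ordinal nP)) //= mE // subnn !expr0 !mulr1 addrAC subrr add0r.
by apply: infinity_sum => a an'; apply: (inf_m (Ordinal p_gt0)).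
Qed.

Lemma infinity_rational : rational_point phi (O1 phi) point_at_infinity.
Proof.
split.
- by move=> z [].
- have O0' : O1 phi 0 by rewrite -constK0; exact: O1_constK.
  by split; rewrite // expr0n (gtn_eqF p_gt0) mulr0.
- exact: infinityD.
- exact: infinityM.
move=> z O; have [c cP] := infinity_residue O; exists c; split=> // c' c'P.
apply/eqP; rewrite -subr_eq0; apply/eqP; apply: infinity_const.
have -> : constK phi (c - c') = (z - constK phi c') + constK phi (-1) * (z - constK phi c).
  rewrite !constKE !polyCB !polyCN !clB !clN !polyC1 cl1.
  by rewrite mulN1r opprB [RHS]addrC addrA subrK.
exact: (infinityD c'P (infinityM (O1_constK _) cP)).
Qed.

(** A function z vanishing at infinity satisfies z^p = (1/x) (x z^p), which lies in
any maximal ideal that contains 1/x. *)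
Lemma infinity_unique M : rational_point phi (O1 phi) M -> M t -> M = point_at_infinity.
Proof.
move=> rM Mt; have [MA M0 MD MM H] := rM.
have zero c : M (constK phi c) -> c = 0 := rational_point_const rM (O1_constK c).
have MN z : M z -> M (- z).
  move=> Mz; have -> : - z = constK phi (-1) * z.
    by rewrite constKE !polyCN clN !polyC1 cl1 mulN1r.
  exact: (MM _ _ (O1_constK _) Mz).
have sub z : point_at_infinity z -> M z.
  case=> Oz Oz'; have zp : M (z ^+ p).
    by have := MM _ _ Oz' Mt; rewrite mulrC mulrA tx mul1r.
  have [c [cM _]] := H _ Oz.
  suff c0 : c = 0 by move: cM; rewrite c0 constK0 subr0.
  have Mp : M ((z - constK phi c) ^+ p).
    by rewrite exp_p mulrC; exact: (MM _ _ (O1X _ (MA _ cM)) cM).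
  have : M (constK phi (c ^+ p)).
    have -> : constK phi (c ^+ p) = z ^+ p - (z - constK phi c) ^+ p.
      have /(congr1 (fun w => w ^+ p)) : z = (z - constK phi c) + constK phi c by rewrite subrK.
      rewrite expDp => E; rewrite {1}E addrAC subrr add0r constKE constKE -clXn.
      by rewrite !polyC_exp.
    exact: MD (MN _ Mp).
  by move/zero => /eqP; rewrite expf_eq0 => /andP[_ /eqP].
rewrite eqEsubset; split=> [z Mz|]; last exact: sub.
have Oz := MA _ Mz; have [c cP] := infinity_residue Oz.
suff c0 : c = 0 by move: cP; rewrite c0 constK0 subr0.
apply: zero; have := MD _ _ Mz (MN _ (sub _ cP)).
by rewrite opprB addrCA subrr addr0.
Qed.

Lemma affine_point_inj u v : on_curve u -> on_curve v -> affine_point u = affine_point v -> u = v.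
Proof.
case: u v => [a b] [a' b'] ou ov E.
have [_ _ _ _ U] := affine_point_rational ou.
have mem w : on_curve w -> affine_point w (cl 'X%:P - constK phi w.1) /\
    affine_point w (cl 'X - constK phi w.2).
  move=> ow; split; [exists ('X%:P - w.1%:P%:P)|exists ('X - w.2%:P%:P)];
    by rewrite ?clB ?constKE // /evalXY !hornerE subrr.
have [m1 m2] := mem _ ou; have [m1' m2'] := mem _ ov; rewrite -E in m1' m2'.
have [c [_ Uc]] := U _ (cl_O0 'X%:P); have [e [_ Ue]] := U _ (cl_O0 'X).
have := (Uc _ m1, Uc _ m1', Ue _ m2, Ue _ m2').
by case=> -[[/= <- <-] <-] <-.
Qed.

Theorem num_points_AS : num_points phi (#|[set u | on_curve u]| + 1)%N.
Proof.
set A := [set u | on_curve u].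
have AP (j : 'I_#|A|) : on_curve (enum_val j) by have := enum_valP j; rewrite inE.
pose h (i : 'I_(#|A|.+1)) : set L + set L :=
  if unlift ord_max i is Some j then inl (affine_point (enum_val j)) else inr point_at_infinity.
have h_inj : injective h.
  move=> i i'; rewrite /h.
  case: unliftP => [j|] ->; case: unliftP => [j'|] -> //.
  by case=> /(affine_point_inj (AP j) (AP j'))/enum_val_inj ->.
rewrite /num_points addn1.
have -> : rational_points phi = (h @` setT)%classic.
  rewrite eqEsubset; split=> [[M|M] /=|_ [i _ <-]].
  - move=> /affine_pointP[u ou ->].
    have uA : u \in A by rewrite inE.
    exists (lift ord_max (enum_rank_in uA u)) => //.
    by rewrite /h liftK enum_rankK_in.
  - by case=> /infinity_unique H /H ->; exists ord_max => //; rewrite /h unlift_none.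
  rewrite /h; case: unliftP => [j|] _ /=; first exact: affine_point_rational.
  by split; [exact: infinity_rational|exact: infinity_xinv].
apply: card_eq_trans (card_esym card_II).
by apply: inj_card_eq => i i' _ _; exact: h_inj.
Qed.

(** * Genus *)

(** The pairs (i, j) for which x^-(j+1) y^(i+1) has a pole at infinity; for
j + 1 >= d there are none. *)
Definition gaps : {set 'I_p.-1 * 'I_d.-1} :=
  [set ij : 'I_p.-1 * 'I_d.-1 | (p * (ij.2).+1 < d * (ij.1).+1)%N].

Lemma card_gaps : (#|gaps| * 2 = p.-1 * d.-1)%N.
Proof.
(* p j = d i is impossible for 0 < i < p, so r exchanges the two sides. *)
pose r (ij : 'I_p.-1 * 'I_d.-1) := (rev_ord ij.1, rev_ord ij.2).
have rK : involutive r by move=> [? ?]; rewrite /r /= !rev_ordK.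
have r_inj := inv_inj rK.
have -> : (p.-1 * d.-1 = #|gaps| + #|~: gaps|)%N by rewrite cardsC card_prod !card_ord.
rewrite muln2 -addnn; congr (_ + _)%N.
rewrite -(card_imset gaps r_inj); apply: eq_card => -[i j].
rewrite -{1}[(i, j)]rK mem_imset // !inE /=.
have ip : (i.+1 < p)%N by have := ltn_ord i; move: p_gt1; lia.
have jd : (j.+1 < d)%N by have := ltn_ord j; move: d_gt0; lia.
have neq : (p * j.+1 != d * i.+1)%N.
  apply/eqP => E; have : (p %| d * i.+1)%N by rewrite -E dvdn_mulr.
  by rewrite Gauss_dvdr // gtnNdvd.
have -> : (p.-1 - i.+1).+1 = (p - i.+1)%N by lia.
have -> : (d.-1 - j.+1).+1 = (d - j.+1)%N by lia.
rewrite !mulnBr -leqNgt [(d * p)%N]mulnC.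
have : (p * j.+1 <= p * d)%N by rewrite leq_mul2l ltnW ?orbT.
have : (d * i.+1 <= p * d)%N by rewrite mulnC leq_mul2r ltnW ?orbT.
move: (p * d)%N (p * j.+1)%N (d * i.+1)%N neq => A B C; lia.
Qed.

Definition gapx (k : 'I_#|gaps|) : nat := (enum_val k).2.+1.
Definition gapy (k : 'I_#|gaps|) : nat := (enum_val k).1.+1.

Lemma gap_lt k : (p * gapx k < d * gapy k)%N.
Proof. by have := enum_valP k; rewrite inE. Qed.

Lemma gapx_lt k : (gapx k < d)%N.
Proof. by rewrite /gapx; have := ltn_ord (enum_val k).2; move: d_gt0; lia. Qed.

Lemma gapy_lt k : (gapy k < p)%N.
Proof. by rewrite /gapy; have := ltn_ord (enum_val k).1; move: p_gt0; lia. Qed.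

Lemma gap_exists i j : (i < p)%N -> (0 < j)%N -> (p * j < d * i)%N ->
  exists k, gapx k = j /\ gapy k = i.
Proof.
move=> ip j0 H.
have i0 : (0 < i)%N by case: i H {ip} => //; rewrite muln0.
have jd : (j < d)%N.
  by rewrite -(ltn_pmul2l p_gt0) (ltn_trans H) // mulnC ltn_pmul2r // d_gt0.
have i' : (i.-1 < p.-1)%N by lia.
have j' : (j.-1 < d.-1)%N by rewrite ltn_predRL prednK.
have mem : (Ordinal i', Ordinal j') \in gaps by rewrite inE /= !prednK.
exists (enum_rank_in mem (Ordinal i', Ordinal j')).
by rewrite /gapx /gapy enum_rankK_in //= !prednK.
Qed.

Lemma gap_inj k k' : gapx k = gapx k' -> gapy k = gapy k' -> k = k'.
Proof.
move=> [ex] [ey]; apply: enum_val_inj.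
by move: ex ey; case: (enum_val k) (enum_val k') => [a b] [a' b'] /= /val_inj -> /val_inj ->.
Qed.

Definition gap_fun (k : 'I_#|gaps|) : L := t ^+ gapx k * y ^+ gapy k.

(** The representation over x^n of a combination of the monomials x^-j y^i, valid
for n >= d since j < d. *)
Definition gap_poly n (e : 'I_#|gaps| -> K) : {poly {poly K}} :=
  \sum_k (e k *: 'X^(n - gapx k))%:P * 'X^(gapy k).

Lemma rep_gap n e : (d <= n)%N -> rep (\sum_k constK phi (e k) * gap_fun k) n (gap_poly n e).
Proof.
move=> dn; split.
  apply: leq_trans (size_sum _ _ _) _; apply/bigmax_leqP => k _.
  rewrite mul_polyC; apply: leq_trans (size_scale_leq _ _) _.
  by rewrite size_polyXn gapy_lt.
rewrite cl_sum mulr_sumr; apply: eq_bigr => k _.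
have kn : (gapx k <= n)%N by rewrite (leq_trans _ dn) // ltnW // gapx_lt.
rewrite clM clXn -mul_polyC polyCM clM -constKE -xX /gap_fun mulrCA -mulrA.
congr (_ * _); rewrite mulrA; congr (_ * _).
exact: (left_inverse_exp tx kn).
Qed.

Lemma coef_gap_poly n e k : (d <= n)%N -> ((gap_poly n e)`_(gapy k))`_(n - gapx k) = e k.
Proof.
move=> dn; rewrite coef_sum coef_sum (bigD1 k) //= big1 ?addr0.
  by rewrite coefCM coefXn eqxx mulr1 coefZ coefXn eqxx mulr1.
move=> k' kk'; rewrite coefCM coefXn; case: eqP => [ey|]; last by rewrite mulr0 coef0.
rewrite mulr1 coefZ coefXn; case: eqP => [ex|]; last by rewrite mulr0.
case/eqP: kk'; apply: gap_inj; last exact/esym.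
by have := gapx_lt k; have := gapx_lt k'; lia.
Qed.

Definition O0_plus_O1 : set L :=
  [set z | exists u v, [/\ O0 phi u, O1 phi v & z = u + v]].

(** The monomials x^a y^i with a >= n go to O0 after division by x^n; each other
one is absent or regular at infinity. *)
Lemma rep_split w n R : rep w n R ->
  (forall i a, (i < p)%N -> (a < n)%N -> (p * (n - a) < d * i)%N -> (R`_i)`_a = 0) ->
  O0_plus_O1 w.
Proof.
case=> sz E H.
pose R0 := \poly_(i < p) drop_poly n R`_i; pose R1 := \poly_(i < p) take_poly n R`_i.
have RE : R = 'X^n *: R0 + R1.
  apply/polyP => i; rewrite coefD coefZ !coef_poly; case: ltnP => ip.
    by rewrite mulrC addrC poly_take_drop.
  by rewrite mulr0 addr0 nth_default // (leq_trans sz).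
exists (cl R0), (w - cl R0); split; last by rewrite addrC subrK.
  exact: cl_O0.
have rw : rep (w - cl R0) n R1.
  split; first exact: size_poly.
  by rewrite mulrBr E RE clD -mul_polyC clM xX addrAC subrr add0r.
apply: (rep_O1 rw) => i; rewrite coef_poly ltn_ord => Ri.
rewrite leqNgt; apply/negP => lt.
set D := (size (take_poly n R`_i)%R).-1 in lt.
have Dn : (D < n)%N.
  rewrite /D prednK ?size_poly_gt0 //; exact: size_take_poly.
move: Ri; rewrite -lead_coef_eq0 lead_coefE -/D coef_take_poly Dn => /eqP; apply.
by apply: H => //; rewrite mulnBr; have := leq_mul (leqnn p) (ltnW Dn); lia.
Qed.

(** Compare the coefficients of x^(n-j) y^i in x^n (u + v): an element of O0
contributes nothing because n - j < n, and one of O1 nothing because p j < d i. *)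
Lemma gap_free e : O0_plus_O1 (\sum_k constK phi (e k) * gap_fun k) -> forall k, e k = 0.
Proof.
case=> u [v [/O0P[U szU ->] Ov E]] k.
have [m [V0 RV0]] := O1_rep Ov; have RV := rep_shift d RV0.
set n := (d + m)%N in RV; set V := _ *: V0 in RV.
have dn : (d <= n)%N by rewrite leq_addr.
have [szE EE] := rep_gap e dn; have [szV VE] := RV.
have GE : gap_poly n e = 'X^n *: U + V.
  apply/eqP; rewrite -subr_eq0; apply/eqP; apply: cl_inj.
    rewrite (leq_trans (size_polyD _ _)) // geq_max szE size_polyN.
    rewrite (leq_trans (size_polyD _ _)) // geq_max szV.
    by rewrite (leq_trans (size_scale_leq _ _)).
  by rewrite clB -EE E mulrDr VE clD -mul_polyC clM xX subrr.
have kn : (gapx k <= n)%N by rewrite (leq_trans _ dn) // ltnW // gapx_lt.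
have kx : (0 < gapx k)%N by [].
rewrite -(coef_gap_poly e k dn) GE coefD coefZ coefD mulrC coefMXn.
have -> : (n - gapx k < n)%N by lia.
rewrite add0r; apply/eqP; case: eqP => // /eqP Vk.
have szVk : (n - gapx k < size (V`_(gapy k))%R)%N.
  by rewrite ltnNge; apply: contra Vk => le; rewrite nth_default.
have Vn0 : V`_(Ordinal (gapy_lt k)) != 0.
  by apply: contraTneq szVk => /= ->; rewrite size_poly0.
have := O1_regular Ov RV Vn0; have := gap_lt k; rewrite /=.
have : (p * (n - gapx k) <= p * (size (V`_(gapy k))%R).-1)%N.
  by rewrite leq_pmul2l // -ltnS prednK // (leq_ltn_trans _ szVk).
rewrite mulnBr; have := leq_mul (leqnn p) kn.
move: (p * gapx k)%N (p * n)%N (d * gapy k)%N (p * _.-1)%N => A B C D; lia.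
Qed.

Lemma O0_plus_O1B z w : O0_plus_O1 z -> O0_plus_O1 w -> O0_plus_O1 (z - w).
Proof.
case=> [u [v [/O0P[U _ ->] Ov ->]]] [_ [v' [/O0P[U' _ ->] Ov' ->]]].
exists (cl (U - U')), (v - v'); split; [exact: cl_O0|exact: O1B|].
by rewrite clB opprD addrACA.
Qed.

Theorem genus_AS : genus phi #|gaps|.
Proof.
exists gap_fun; split.
  move=> k; apply/O01P; exists d, (gap_poly d (fun k' => (k' == k)%:R)).
  have := rep_gap (fun k' => (k' == k)%:R) (leqnn d).
  rewrite (bigD1 k) //= eqxx big1 ?addr0.
    by rewrite constKE !polyC1 cl1 mul1r.
  by move=> i /negPf ->; rewrite constK0 mul0r.
move=> z /O01P[m [P0 R0]]; have R := rep_shift d R0.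
set n := (d + m)%N in R; set P := _ *: P0 in R.
have dn : (d <= n)%N by rewrite leq_addr.
pose c : {ffun 'I_#|gaps| -> K} := [ffun k => (P`_(gapy k))`_(n - gapx k)].
have [szP PE] := R; have [szG GE] := rep_gap c dn.
have cP : O0_plus_O1 (z - \sum_k constK phi (c k) * gap_fun k).
  apply: (@rep_split _ n (P - gap_poly n c)).
    split; last by rewrite mulrBr PE GE clB.
    by rewrite (leq_trans (size_polyD _ _)) // geq_max szP size_polyN.
  move=> i a ip an H; have [|k [kx ky]] := gap_exists ip _ H; first by rewrite subn_gt0.
  have aE : a = (n - gapx k)%N by rewrite kx; lia.
  by rewrite aE -ky !coefB coef_gap_poly // ffunE subrr.
exists c; split=> // c' c'P.
have := O0_plus_O1B c'P cP.
have -> : z - \sum_k constK phi (c' k) * gap_fun k - (z - \sum_k constK phi (c k) * gap_fun k)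
    = \sum_k constK phi (c k - c' k) * gap_fun k.
  rewrite opprB addrC addrA subrK -sumrB; apply: eq_bigr => k _.
  by rewrite !constKE !polyCB clB mulrBl.
move/gap_free => e0; apply/ffunP => k.
by apply/eqP; rewrite -subr_eq0 e0.
Qed.
End FunctionField.

(** * Maximal and minimal curves *)

(** The sign (-1)^(n+1) is that of the sum S(g) = (-Q)^(n+3). *)
Theorem artin_schreier_invariants (p l n : nat) (K : finFieldType)
    (p_prime : prime p) (p_odd : odd p) (l_gt0 : (0 < l)%N) (n4 : (4 <= n)%N)
    (cardK : #|K| = ((p ^ l) ^ (2 * n))%N) :
  exists g1 g2 : K, exists N g : nat, [/\ g1 != 0, g2 != 0,
    num_points (AS_embed p (g1 *: 'X^(p ^ (3 * l) + 1) + g2 *: 'X^(p ^ l + 1) + 0 *: 'X)) N,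
    genus (AS_embed p (g1 *: 'X^(p ^ (3 * l) + 1) + g2 *: 'X^(p ^ l + 1) + 0 *: 'X)) g
    & N%:R = #|K|%:R + 1 + (-1) ^+ n.+1 * (2 * g%:R * sqrtC #|K|%:R) :> algC].
Proof.
set Q := (p ^ l)%N in cardK.
have cardKp : #|K| = (p ^ (l * (2 * n)))%N by rewrite cardK /Q -expnM.
have [psi [psi0 psiD psiF psi1]] := exists_additive_character p_prime cardKp.
have [[g1 g2] /= [g10 g20 S]] := exists_hsum p_prime p_odd l_gt0 cardK psi0 psiD psiF psi1 n4.
have C := curve_count p_prime p_odd l_gt0 cardK psi0 psiD psiF psi1 (g1, g2).
exists g1, g2; set f := _ + _ + _.
have Q3 : (p ^ (3 * l) = Q ^ 3)%N by rewrite /Q -expnM mulnC.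
have Q1 : (1 < Q)%N by rewrite ltnW // odd_pow_gt2.
have fE x : f.[x] = hform p l (g1, g2) x.
  by rewrite /f /hform /= !hornerE Q3 -/Q.
have szf : size f = (Q ^ 3 + 2)%N.
  rewrite /f scale0r addr0 Q3 -/Q size_polyDl !size_scale // !size_polyXn ?addnS //.
  by rewrite !addn0 !ltnS -[X in (X < _)%N]expn1 ltn_exp2l.
have d_coprime : coprime p (size f).-1.
  rewrite szf addnS /= addn1 /Q -expnM -(@prednK (l * 3)) ?muln_gt0 ?l_gt0 // expnS.
  by rewrite -coprime_modr -addn1 mulnC modnMDl coprime_modr coprimen1.
have pK := pcharK p_prime cardKp.
(* deg f = Q^3 + 1, so the genus is (p-1) Q^3 / 2. *)
exists (#|[set u : K * K | on_curve p f u]| + 1)%N, #|gaps p f|; split => //.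
- exact: num_points_AS.
- exact: genus_AS.
have -> : #|[set u : K * K | on_curve p f u]| = 
   #|[set u : K * K | u.2 ^+ p - u.2 == hform p l (g1, g2) u.1]|.
  by apply: eq_card => u; rewrite !inE /on_curve fE.
rewrite natrD C S.
have gE : (#|gaps p f| * 2 = p.-1 * Q ^ 3)%N.
  by rewrite (card_gaps p_prime pK d_coprime); congr (_ * _)%N; rewrite szf addn2.
have -> : sqrtC #|K|%:R = Q%:R ^+ n :> algC.
  by rewrite cardK mulnC expnM natrX sqrCK ?ler0n // natrX.
have -> : 2 * #|gaps p f|%:R = p.-1%:R * Q%:R ^+ 3 :> algC.
  by rewrite -natrX -!natrM mulnC gE.
rewrite -addrA [_ + 1]addrC addrA; congr (_ + _).
rewrite rmorphXn rmorphN rmorph_nat -/Q [(- Q%:R) ^+ _]exprNn addnC !exprD [in RHS]exprS.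
by move: ((-1) ^+ n) => e; ring.
Qed.

Theorem proposition6p5 (p m l : nat) (K : finFieldType)
    (p_prime : prime p) (p_odd : odd p) (m_gt0 : (0 < m)%N) (l_gt0 : (0 < l)%N)
    (l_dvd_m : (l %| m)%N) (ml_even : ~~ odd (m %/ l)%N)
    (m_gt6l : (6 * l < m)%N) (cardK : #|K| = (p ^ m)%N) :
  let f (g1 g2 b : K) : {poly K} :=
    g1 *: 'X^(p ^ (3 * l) + 1) + g2 *: 'X^(p ^ l + 1) + b *: 'X in
  (odd ((m %/ l)./2) ->
     exists g1 g2 b : K, [/\ g1 != 0, g2 != 0
       & maximal (AS_embed p (f g1 g2 b))]) /\
  (~~ odd ((m %/ l)./2) ->
     exists g1 g2 b : K, [/\ g1 != 0, g2 != 0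
       & minimal (AS_embed p (f g1 g2 b))]).
Proof.
move=> f; set n := (m %/ l)./2.
have mE : m = (l * (2 * n))%N.
  by rewrite mul2n /n halfK (negPf ml_even) subn0 mulnC divnK.
have n4 : (4 <= n)%N by move: m_gt6l; rewrite mE; nia.
have cardKQ : #|K| = ((p ^ l) ^ (2 * n))%N by rewrite cardK mE expnM.
have [g1 [g2 [N [g [g10 g20 HN Hg E]]]]] := artin_schreier_invariants p_prime p_odd l_gt0 n4 cardKQ.
rewrite exprS mulN1r -signr_odd in E.
split=> n_odd; exists g1, g2, 0; split=> //; exists N, g; split=> //.
  by rewrite E n_odd opprK mul1r.
by rewrite E (negPf n_odd) expr0 mulN1r.
Qed.
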